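(* Let $\Omega,\varepsilon,\boldsymbol{b},c,g$, the triangulation $\mathscr{T}_h$ with vertices $x_1,\dots,x_N$, the space $W_h$ with basis $\varphi_1,\dots,\varphi_N$, the bilinear form $a_h$ (either of the two choices), and the numbers $a_{ij}=a_h(\varphi_j,\varphi_i)$, $g_i=(g,\varphi_i)$ be as in the context. For $i=1,\dots,M$ let $$S_i=\{j\in\{1,\dots,N\}\setminus\{i\}\,;\ x_i \text{ and } x_j \text{ are end points of the same edge of } \mathscr{T}_h\}.$$ For every $\mathrm{U}\in\mathbb{R}^N$ let $\mathbb{B}(\mathrm{U})=(b_{ij}(\mathrm{U}))_{i,j=1}^N$ be a real matrix such that, for all $\mathrm{U}$: $b_{ij}(\mathrm{U})=b_{ji}(\mathrm{U})$ for $i,j=1,\dots,N$; $b_{ij}(\mathrm{U})\le 0$ for $i\ne j$, $i,j=1,\dots,N$; $\sum_{j=1}^N b_{ij}(\mathrm{U})=0$ for $i=1,\dots,N$; and $b_{ij}(\mathrm{U})=0$ for all $i=1,\dots,M$ and $j\notin S_i\cup\{i\}$. Assume: (A1) for any $i\in\{1,\dots,M\}$ and $j\in\{1,\dots,N\}$, the function $\mathrm{U}=(u_1,\dots,u_N)\mapsto b_{ij}(\mathrm{U})(u_j-u_i)$ is continuous on $\mathbb{R}^N$, and for any $i\in\{1,\dots,M\}$ and $j\in\{M+1,\dots,N\}$, the function $b_{ij}$ is bounded on $\mathbb{R}^N$; (A2) for any $\mathrm{U}=(u_1,\dots,u_N)\in\mathbb{R}^N$ and any $i\in\{1,\dots,M\}$,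 if either $u_i>u_j$ for all $j\in S_i$ or $u_i<u_j$ for all $j\in S_i$, then $a_{ij}+b_{ij}(\mathrm{U})\le0$ for all $j\in S_i$. Consider any nonempty set $\mathscr{G}_h\subset\mathscr{T}_h$ and define $G_h=\bigcup_{T\in\mathscr{G}_h}T$. Let $\mathrm{U}=(u_1,\dots,u_N)\in\mathbb{R}^N$ satisfy $\sum_{j=1}^N (a_{ij}+b_{ij}(\mathrm{U}))\,u_j=g_i$ for $i=1,\dots,M$, and let $u_h=\sum_{i=1}^N u_i\varphi_i\in W_h$. Then $$g\le0\ \text{ in } G_h\quad\Rightarrow\quad \max_{G_h}u_h\le\max_{\partial G_h}u_h^+,$$ $$g\ge0\ \text{ in } G_h\quad\Rightarrow\quad \min_{G_h}u_h\ge\min_{\partial G_h}u_h^-.$$ If, in addition, $c=0$ in $G_h$, then $$g\le0\ \text{ in } G_h\quad\Rightarrow\quad \max_{G_h}u_h=\max_{\partial G_h}u_h,$$ $$g\ge0\ \text{ in } G_h\quad\Rightarrow\quad \min_{G_h}u_h=\min_{\partial G_h}u_h.$$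
   Context: $\Omega\subset\mathbb{R}^d$, $d\ge1$, is a bounded domain with Lipschitz-continuous boundary $\partial\Omega$ that is polyhedral if $d\ge2$. The data are: a constant $\varepsilon>0$, $\boldsymbol{b}\in W^{1,\infty}(\Omega)^d$ with $\nabla\cdot\boldsymbol{b}=0$ in $\Omega$, $c\in L^\infty(\Omega)$ with $c\ge\sigma_0\ge0$ in $\Omega$ for a constant $\sigma_0$, and $g\in L^2(\Omega)$ (coefficients of the problem $-\varepsilon\Delta u+\boldsymbol{b}\cdot\nabla u+c\,u=g$ in $\Omega$ with Dirichlet boundary conditions). $(\cdot,\cdot)$ is the inner product in $L^2(\Omega)$ or $L^2(\Omega)^d$. $\mathscr{T}_h$ is a (conforming) simplicial triangulation of $\overline\Omega$, $W_h=\{v_h\in C(\overline\Omega)\,;\ v_h|_T\in\mathbb{P}_1(T)\ \forall\,T\in\mathscr{T}_h\}$ is the space of continuous piecewise linear functions, and $V_h=W_h\cap H^1_0(\Omega)$. The vertices of $\mathscr{T}_h$ are $x_1,\dots,x_N$, with $x_1,\dots,x_M\in\Omega$ and $x_{M+1},\dots,x_N\in\partial\Omega$, $0<M<N$. The basis functions $\varphi_i\in W_h$ satisfy $\varphi_i(x_j)=\delta_{ij}$. The bilinear form $a_h$ is either $a_h=a$ with $$a(u,v)=\varepsilon(\nabla u,\nabla v)+(\boldsymbol{b}\cdot\nabla u,v)+(c\,u,v),$$ or the form with lumped reaction term $$a_h(u_h,v_h)=\varepsilon(\nabla u_h,\nabla v_h)+(\boldsymbol{b}\cdot\nabla u_h,v_h)+\sum_{i=1}^M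 (c,\varphi_i)\,u_h(x_i)\,v_h(x_i),\qquad u_h\in W_h,\ v_h\in V_h.$$ Set $a_{ij}=a_h(\varphi_j,\varphi_i)$ for $i=1,\dots,M$, $j=1,\dots,N$, and $g_i=(g,\varphi_i)$ for $i=1,\dots,M$. For a real-valued function or number, $u^+=\max\{u,0\}$ and $u^-=\min\{u,0\}$. $\partial G_h$ denotes the topological boundary of $G_h$ in $\mathbb{R}^d$. Inequalities and equalities for $g$ and $c$ in $G_h$ are meant almost everywhere. *)

(* Defs.v *)
From HB Require Import structures.
From mathcomp Require Import all_boot all_order all_algebra.
From mathcomp Require Import all_classical all_reals all_analysis.

Set Implicit Arguments.
Unset Strict Implicit.
Unset Printing Implicit Defensive.

Import Order.TTheory GRing.Theory Num.Theory.
Import numFieldNormedType.Exports.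

Local Open Scope classical_set_scope.
Local Open Scope ring_scope.

(* R^d is 'rV[R]_d.  Its sigma-algebra is generated by the coordinate maps, as
   for n.-tuple; since R is second countable it is the Borel one. *)

Definition rV_display : measure_display.
Proof. by constructor. Qed.

Section rV_measurable.
Context {R : realType} {n : nat}.

Definition rV_coord (i : 'I_n) (x : 'rV[R]_n) : measurableTypeR R := x ord0 i.

Let rV_set0 : g_sigma_preimage rV_coord set0.
Proof. exact: sigma_algebra0. Qed.

Let rV_setC A : g_sigma_preimage rV_coord A -> g_sigma_preimage rV_coord (~` A).
Proof. exact: sigma_algebraC. Qed.

Let rV_bigcup (F : (set 'rV[R]_n)^nat) :
  (forall i, g_sigma_preimage rV_coord (F i)) ->
  g_sigma_preimage rV_coord (\bigcup_i F i).
Proof. exact: sigma_algebra_bigcup. Qed.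

HB.instance Definition _ := @isMeasurable.Build rV_display 'rV[R]_n
  (g_sigma_preimage rV_coord) rV_set0 rV_setC rV_bigcup.

Lemma measurable_rV_coord (i : 'I_n) :
  measurable_fun [set: 'rV[R]_n] (rV_coord i).
Proof.
move=> _ Y mY; rewrite setTI; apply: sub_sigma_algebra => /=.
rewrite -bigcup_seq/=; exists i => /=; first by rewrite mem_index_enum.
by exists Y => //; rewrite setTI.
Qed.

Lemma measurable_fun_rVP d (T : measurableType d) (f : T -> 'rV[R]_n) :
  (forall i, measurable_fun [set: T] (rV_coord i \o f)) ->
  measurable_fun [set: T] f.
Proof.
move=> mf _ A mA; rewrite setTI.
suff: (g_sigma_preimage rV_coord) `<=` [set B | measurable (f @^-1` B)].
  exact.
apply: smallest_sub => /=.
  split => /=.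
  - by rewrite preimage_set0.
  - by move=> B mB; rewrite setTD preimage_setC; exact: measurableC.
  - by move=> F mF; rewrite preimage_bigcup; exact: bigcup_measurable.
move=> B; rewrite -bigcup_seq /= => -[i _ [C mC <-]].
by rewrite /= setTI -[X in measurable X]setTI; exact: (mf i).
Qed.

End rV_measurable.

Section lebesgue_rV.
Context {R : realType}.

Definition cons_rV n (p : measurableTypeR R * 'rV[R]_n) : 'rV[R]_n.+1 :=
  row_mx (p.1%:M : 'rV_1) p.2.

Definition uncons_rV n (x : 'rV[R]_n.+1) : measurableTypeR R * 'rV[R]_n :=
  (x ord0 ord0, \row_i x ord0 (lift ord0 i)).

Lemma cons_rV0 n p : @cons_rV n p ord0 ord0 = p.1.
Proof.
rewrite /cons_rV (_ : ord0 = lshift n (ord0 : 'I_1)); last exact/val_inj.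
by rewrite (@row_mxEl _ _ 1) mxE eqxx mulr1n.
Qed.

Lemma cons_rVS n p i : @cons_rV n p ord0 (lift ord0 i) = p.2 ord0 i.
Proof.
rewrite /cons_rV (_ : lift ord0 i = rshift 1 i); last exact/val_inj.
by rewrite (@row_mxEr _ _ 1).
Qed.

Lemma cons_rVK n : cancel (@cons_rV n) (@uncons_rV n).
Proof.
move=> [a x]; rewrite /uncons_rV cons_rV0; congr (_, _).
by apply/rowP => i; rewrite mxE cons_rVS.
Qed.

Lemma measurable_cons_rV n : measurable_fun [set: _] (@cons_rV n).
Proof.
apply: measurable_fun_rVP => i; case: (unliftP ord0 i) => [j ->|->].
- rewrite (_ : _ \o _ = rV_coord j \o snd); last first.
    by apply/funext => p; exact: cons_rVS.
  by apply: measurableT_comp; [exact: measurable_rV_coord|exact: measurable_snd].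
- rewrite (_ : _ \o _ = fst); last by apply/funext => p; exact: cons_rV0.
  exact: measurable_fst.
Qed.

Lemma measurable_uncons_rV n : measurable_fun [set: _] (@uncons_rV n).
Proof.
apply: measurable_fun_pair => /=; first exact: (measurable_rV_coord ord0).
apply: measurable_fun_rVP => i.
rewrite (_ : _ \o _ = rV_coord (lift ord0 i)); first exact: measurable_rV_coord.
by apply/funext => x; rewrite /rV_coord /= mxE.
Qed.

Section step.
Variables (n : nat) (mu : {sigma_finite_measure set 'rV[R]_n -> \bar R}).

Definition lebesgue_rV_step : set 'rV[R]_n.+1 -> \bar R :=
  pushforward (@lebesgue_measure R \x mu)%E (@cons_rV n).

Let step0 : lebesgue_rV_step set0 = 0%E.
Proof. by rewrite /lebesgue_rV_step /pushforward preimage_set0 measure0. Qed.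

Let step_ge0 A : (0 <= lebesgue_rV_step A)%E.
Proof. by rewrite /lebesgue_rV_step /pushforward measure_ge0. Qed.

Let step_sigma_additive : semi_sigma_additive lebesgue_rV_step.
Proof.
move=> F mF tF mUF; rewrite /lebesgue_rV_step /pushforward preimage_bigcup.
have mcF A : measurable A -> measurable (@cons_rV n @^-1` A).
  by move=> mA; rewrite -[X in measurable X]setTI; exact: measurable_cons_rV.
apply: measure_semi_sigma_additive.
- by move=> i; exact: mcF.
- apply/trivIsetP => /= i j _ _ ij; rewrite -preimage_setI.
  by move/trivIsetP : tF => /(_ _ _ _ _ ij) ->//; rewrite preimage_set0.
- by rewrite -preimage_bigcup; exact: mcF.
Qed.

HB.instance Definition _ := isMeasure.Build _ _ _ lebesgue_rV_step
  step0 step_ge0 step_sigma_additive.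

Let step_sigma_finite : sigma_finite setT lebesgue_rV_step.
Proof.
have /sigma_finiteP[F [TF ndF Foo]] := sigma_finiteT (@lebesgue_measure R).
have /sigma_finiteP[G [TG ndG Goo]] := sigma_finiteT mu.
exists (fun k => @uncons_rV n @^-1` (F k `*` G k)).
  rewrite -preimage_bigcup (_ : \bigcup_k _ = setT) ?preimage_setT//.
  apply/seteqP; split => // -[a x] _.
  have [i _ Fia] : (\bigcup_k F k) a by rewrite -TF.
  have [j _ Gjx] : (\bigcup_k G k) x by rewrite -TG.
  exists (maxn i j) => //; split => /=.
  - by move: a Fia; exact/subsetPset/ndF/leq_maxl.
  - by move: x Gjx; exact/subsetPset/ndG/leq_maxr.
move=> k; have [mF Fk] := Foo k; have [mG Gk] := Goo k.
have mFG : measurable (F k `*` G k) by exact: measurableX.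
split; first by rewrite -[X in measurable X]setTI; exact: measurable_uncons_rV.
rewrite /lebesgue_rV_step /pushforward -comp_preimage.
rewrite (_ : _ \o _ = id); last by apply/funext => p /=; exact: cons_rVK.
by rewrite preimage_id product_measure1E// lte_mul_pinfty// ge0_fin_numE.
Qed.

HB.instance Definition _ := Measure_isSigmaFinite.Build _ _ _ lebesgue_rV_step
  step_sigma_finite.

End step.

(* Lebesgue measure on R^n, transported along R * R^m ~ R^(m+1) from the product
   measures. *)
Fixpoint lebesgue_rV (n : nat) :
    {sigma_finite_measure set 'rV[R]_n -> \bar R} :=
  match n with
  | 0 => \d_(0 : 'rV[R]_0)
  | m.+1 => lebesgue_rV_step (lebesgue_rV m)
  end.

Lemma lebesgue_rV_box n (A : 'I_n -> set R) :
  (forall i, measurable (A i : set (measurableTypeR R))) ->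
  lebesgue_rV n [set x | forall i, A i (x ord0 i)] =
  (\prod_(i < n) lebesgue_measure (A i))%E.
Proof.
elim: n A => [|n ih] A mA /=.
  rewrite big_ord0 diracE mem_set//= => -[]//.
rewrite big_ord_recl /= -(ih (fun i => A (lift ord0 i))) => [|i]; last exact: mA.
rewrite /lebesgue_rV_step /pushforward.
pose B : set 'rV[R]_n := [set x | forall i, A (lift ord0 i) (x ord0 i)].
have mB : measurable B.
  rewrite (_ : B = \bigcap_(i in [set: 'I_n])
      (rV_coord i @^-1` A (lift ord0 i))); last first.
    by apply/seteqP; split => x /= => [h i _|h i]; [exact: h|exact: h].
  apply: fin_bigcap_measurable => // i _.
  by rewrite -[X in measurable X]setTI; apply: measurable_rV_coord.
rewrite -[RHS](@product_measure1E _ _ _ _ _ (@lebesgue_measure R) _ _ B)//; congr (product_measure1 _ _ _).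
apply/seteqP; split => -[a x] /= => [h|[h1 h2] i].
  split; first by have := h ord0; rewrite cons_rV0.
  by move=> i; have := h (lift ord0 i); rewrite cons_rVS.
by case: (unliftP ord0 i) => [j ->|->]; rewrite ?cons_rV0 ?cons_rVS//; exact: h2.
Qed.

End lebesgue_rV.

Section euclidean_domains.
Context {R : realType} {d : nat}.
Implicit Types (A Omega : set 'rV[R]_d) (x y n : 'rV[R]_d).

Definition boundary A : set 'rV[R]_d := closure A `\` A°.

Definition dotv x y : R := \sum_(k < d) x ord0 k * y ord0 k.

Definition orth_proj n y : 'rV[R]_d := y - dotv y n *: n.

(* Near every boundary point x0, in coordinates centered at x0 with last axis
   along the unit vector n, Omega is the part of a cylinder of radius r and
   half-height h lying strictly below the graph of a Lipschitz function gamma of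
   the remaining coordinates, i.e. of orth_proj n y.  The norm is the library's
   sup norm; changing it only changes r and the Lipschitz constant. *)
Definition lipschitz_boundary Omega : Prop :=
  forall x0, boundary Omega x0 ->
  exists (n : 'rV[R]_d) (r h : R) (gamma : 'rV[R]_d -> R),
    [/\ dotv n n = 1, 0 < r, 0 < h, lipschitz gamma &
        (forall y, `|orth_proj n y| < r -> `|gamma (orth_proj n y)| < h) /\
        (forall y, `|orth_proj n y| < r -> `|dotv y n| < h ->
           (Omega (x0 + y) <-> dotv y n < gamma (orth_proj n y)))].

Definition bounded_domain Omega : Prop :=
  [/\ Omega !=set0, open Omega, connected Omega & bounded_set Omega].

(* convex hull of the points p i, i in T; empty if T is *)
Definition hull (I : finType) (p : I -> 'rV[R]_d) (T : {set I}) :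
    set 'rV[R]_d :=
  [set y | exists w : I -> R,
     [/\ forall i, i \in T -> 0 <= w i, \sum_(i in T) w i = 1 &
         y = \sum_(i in T) w i *: p i]].

Definition cells (I : finType) (p : I -> 'rV[R]_d) (F : {set {set I}}) :
    set 'rV[R]_d :=
  \bigcup_(T in [set` F]) hull p T.

(* finite union of convex polytopes *)
Definition polyhedral A : Prop :=
  exists (k : nat) (p : 'I_k -> 'rV[R]_d) (F : {set {set 'I_k}}), A = cells p F.

Definition affinely_independent (I : finType) (p : I -> 'rV[R]_d)
    (T : {set I}) : Prop :=
  forall w : I -> R, \sum_(i in T) w i = 0 -> \sum_(i in T) w i *: p i = 0 ->
  forall i, i \in T -> w i = 0.

End euclidean_domains.

Section finite_elements.
Context {R : realType} {d N : nat}.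
Variables (Omega : set 'rV[R]_d) (p : 'I_N -> 'rV[R]_d) (Th : {set {set 'I_N}}).

(* A simplex is given by the set of indices of its d+1 vertices. *)
Definition triangulation : Prop :=
  [/\ injective p /\ (forall i, exists2 T, T \in Th & i \in T),
      forall T, T \in Th -> #|T| = d.+1 /\ affinely_independent p T,
      cells p Th = closure Omega &
      forall S T, S \in Th -> T \in Th ->
        hull p S `&` hull p T = hull p (S :&: T)%SET].

(* Any two distinct vertices of a simplex are the end points of an edge. *)
Definition neighbours (i : 'I_N) : {set 'I_N} :=
  [set j | (j != i) && [exists T in Th, (i \in T) && (j \in T)]]%SET.

(* Elements of W_h are functions on all of R^d of which only the values on
   closure Omega matter. *)
Definition P1_space (u : 'rV[R]_d -> R) : Prop :=
  {within closure Omega, continuous u} /\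
  forall T, T \in Th -> exists (q : 'rV[R]_d) (r : R),
    forall y, hull p T y -> u y = dotv q y + r.

Definition nodal_basis (phi : 'I_N -> 'rV[R]_d -> R) : Prop :=
  forall i, P1_space (phi i) /\ forall j, phi i (p j) = (i == j)%:R.

End finite_elements.

Section function_spaces.
Context {R : realType} {d : nat}.
Variable Omega : set 'rV[R]_d.

Definition Lp_space (q : \bar R) (f : 'rV[R]_d -> R) : Prop :=
  measurable_fun Omega f /\ finite_norm (lebesgue_rV d) q (f \_ Omega).

Definition partial (k : 'I_d) (f : 'rV[R]_d -> R) : 'rV[R]_d -> R :=
  fun x => 'D_(delta_mx ord0 k) f x.

Definition smooth (f : 'rV[R]_d -> R) : Prop :=
  forall s : seq 'I_d, let g := foldr partial f s in
    continuous g /\ forall (k : 'I_d) x, derivable g x (delta_mx ord0 k).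

Definition test_function (psi : 'rV[R]_d -> R) : Prop :=
  let supp := closure [set x | psi x != 0] in
  [/\ smooth psi, compact supp & supp `<=` Omega].

Definition weak_partial (k : 'I_d) (f h : 'rV[R]_d -> R) : Prop :=
  forall psi, test_function psi ->
    \int[lebesgue_rV d]_(x in Omega) (f x * partial k psi x) =
    - \int[lebesgue_rV d]_(x in Omega) (h x * psi x).

Definition W1oo (f : 'rV[R]_d -> R) : Prop :=
  Lp_space +oo f /\
  forall k, exists2 h, Lp_space +oo h & weak_partial k f h.

Definition divergence_free (b : 'rV[R]_d -> 'rV[R]_d) : Prop :=
  exists D : 'I_d -> 'rV[R]_d -> R,
    (forall k, Lp_space +oo (D k) /\
               weak_partial k (fun x => b x ord0 k) (D k)) /\
    {ae lebesgue_rV d, forall x, Omega x -> \sum_(k < d) D k x = 0}.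

End function_spaces.

Section bilinear_forms.
Context {R : realType} {d N : nat}.
Variables (Omega : set 'rV[R]_d) (eps : R) (b : 'rV[R]_d -> 'rV[R]_d)
  (c : 'rV[R]_d -> R).
Implicit Types u v : 'rV[R]_d -> R.

Definition innerL2 u v : R := \int[lebesgue_rV d]_(x in Omega) (u x * v x).

(* On W_h the partial derivatives are the classical ones, which exist in the
   interior of every simplex, hence almost everywhere. *)
Definition diffusion_convection u v : R :=
  eps * (\int[lebesgue_rV d]_(x in Omega)
           (\sum_(k < d) partial k u x * partial k v x)) +
  innerL2 (fun x => \sum_(k < d) b x ord0 k * partial k u x) v.

Definition form_a u v : R :=
  diffusion_convection u v + innerL2 (fun x => c x * u x) v.

Definition form_a_lumped (M : nat) (p : 'I_N -> 'rV[R]_d)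
    (phi : 'I_N -> 'rV[R]_d -> R) u v : R :=
  diffusion_convection u v +
  \sum_(i < N | (i < M)%N) innerL2 c (phi i) * u (p i) * v (p i).

End bilinear_forms.

Section extrema.
Context {R : realType} {T : Type}.
Implicit Types (f : T -> R) (A : set T) (m : R).

Definition is_max f A m : Prop := (f @` A) m /\ forall x, A x -> f x <= m.

Definition is_min f A m : Prop := (f @` A) m /\ forall x, A x -> m <= f x.

End extrema.

(* Main.v *)
Require Import Defs.
From mathcomp Require Import all_boot all_order all_algebra.
From mathcomp Require Import all_classical all_reals all_analysis.
From mathcomp Require Import measurable_realfun ess_sup_inf.
From mathcomp Require Import ring lra.

Import Order.TTheory GRing.Theory Num.Theory.
Import numFieldNormedType.Exports.

Set Implicit Arguments.
Unset Strict Implicit.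
Unset Printing Implicit Defensive.

Local Open Scope classical_set_scope.
Local Open Scope ring_scope.

(** Let [s = max_G u_h] and suppose that [s > max_dG u_h], where [s > 0] or [c = 0] in
    [G].  Every vertex [i] of the cells of [G] with [u_i = s] is then interior to [G];
    let [J] be the set of these vertices.
    Raising [u_i] by [alpha > 0] makes [i] a strict local maximum, so (A2), and (A1) as
    [alpha -> 0], make each term of [sum_j (a_ij + b_ij(U)) (u_j - s) = g_i - s (c, phi_i)]
    nonnegative, whereas the right-hand side is nonpositive.  Hence [a_ij + b_ij(U) = 0]
    for [i] in [J] and [j] outside of [J], and the sum of [a_ij + b_ij(U)] over [J x J] is
    [sum_(i in J) (c, phi_i) <= 0].  But this sum is at least [a_h(w, w) > 0] for
    [w = sum_(i in J) phi_i].

    The positivity of [a_h(w, w)] requires [int b . grad (w^2) = 0], whereas [b] is only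
    known to be divergence free against smooth compactly supported functions.  The
    Lipschitz functions [((w - k)^+)^2] have compact support in [Omega].  They are sampled
    on a grid of width [del] and interpolated with a smooth kernel that reproduces affine
    functions; the gradients of the interpolants stay bounded as [del -> 0] and converge
    in the interior of every cell, so dominated convergence applies.  The minimum
    principle follows by changing the sign of [U]. *)

(** * Smooth functions of one variable *)

Section smooth_bump.
Context {R : realType}.
Implicit Types (f g : R -> R) (p : {poly R}).

(** Interpolation is used in place of convolution because each approximant is then a finite sum of
    products of one-variable functions, a class visibly closed under differentiation. One estimate
    serves both ends of the limit: where the sampled function stays within [E] of an affine function
    up to distance [3 * delta], the gradient of the interpolant differs from the slope by at most
    [2 * E / delta]. A Lipschitz bound makes [E] of order delta and yields the uniform gradient
    bound; inside a cell, Taylor's formula makes [E] of order delta^2 and yields convergence. The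
    truncation level k and the width delta are coupled, so that interpolation enlarges the set w > k
    at most to w >= k/2. This set is compact in Omega because w, extended by zero, is Lipschitz and
    positive only in Omega. The last point is where the Lipschitz boundary enters: the interior of
    the closure of Omega is Omega itself. *)

Definition smooth1 f := exists2 F : nat -> R -> R, F 0%N = f &
  forall n (x : R), is_derive x (1 : R) (F n) (F n.+1 x).

Lemma is_derive_cvg (V W : normedModType R) (h : V -> W) (a v : V) (l : W) :
  (t^-1 *: (h (t *: v + a) - h a)) @[t --> (0 : R)^'] --> l -> is_derive a v h l.
Proof.
by move=> hl; split; [apply/cvg_ex; exists l|apply: (cvg_lim _ hl)].
Qed.

Lemma smooth1_derive f : smooth1 f ->
  exists2 g, smooth1 g & forall x : R, is_derive x (1 : R) f (g x).
Proof.
move=> [F <- dF]; exists (F 1%N) => [|x]; last exact: dF.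
by exists (fun n => F n.+1) => // n x; exact: dF.
Qed.

(** Iterating a choice of derivatives inside [P] produces the sequence required by [smooth1]. It is
    meant for classes closed under differentiation. *)
Lemma smooth1_coind (P : (R -> R) -> Prop) :
  (forall f, P f -> exists2 g, P g & forall x : R, is_derive x (1 : R) f (g x)) ->
  forall f, P f -> smooth1 f.
Proof.
move=> coP f Pf.
have /choice[D dD] : forall f, exists g, P f ->
    P g /\ forall x : R, is_derive x (1 : R) f (g x).
  move=> u; have [/coP[v Pv dv]|nPu] := pselect (P u); last by exists u.
  by exists v.
have PD n : P (iter n D f) by elim: n => //= n ih; have [] := dD _ ih.
exists (fun n => iter n D f) => // n x /=.
by have [_] := dD _ (PD n); exact.
Qed.

Lemma smooth1_primitive f g : smooth1 g ->
  (forall x : R, is_derive x (1 : R) f (g x)) -> smooth1 f.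
Proof.
move=> [G G0 dG] df; exists (fun n => if n is m.+1 then G m else f) => // -[|n] x.
  by rewrite G0; exact: df.
exact: dG.
Qed.

Lemma smooth1_affine f a b : smooth1 f -> smooth1 (fun t => f (a * t + b)).
Proof.
move=> [F F0 dF]; exists (fun n t => a ^+ n * F n (a * t + b)).
  by apply/funext => t; rewrite F0 expr0 mul1r.
move=> n x.
have da : is_derive x (1 : R) (fun t : R => a * t + b) a.
  by apply: is_derive_eq; rewrite /GRing.scale /= ?mulr1 ?addr0.
have dc := @is_derive1_comp R (F n) (fun t => a * t + b) x _ _ (dF n _) da.
have := is_deriveZ (a ^+ n) dc; move=> /is_derive_eq; apply.
by rewrite /GRing.scale /= exprSr; ring.
Qed.

Inductive sum_of_products : (R -> R) -> Prop :=
| SPmul f g : smooth1 f -> smooth1 g -> sum_of_products (f \* g)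
| SPadd f g : sum_of_products f -> sum_of_products g -> sum_of_products (f \+ g).

Lemma smooth1_sum_of_products f : sum_of_products f -> smooth1 f.
Proof.
move: f; apply: smooth1_coind => f; elim=> {f} [f g sf sg|f g _ [f' sf df] _ [g' sg dg]].
  have [f' sf' df] := smooth1_derive sf; have [g' sg' dg] := smooth1_derive sg.
  exists ((f \* g') \+ (g \* f')) => [|x].
    by apply: SPadd; apply: SPmul.
  exact: is_deriveM.
exists (f' \+ g') => [|x]; first exact: SPadd.
exact: is_deriveD.
Qed.

Lemma smooth1M f g : smooth1 f -> smooth1 g -> smooth1 (f \* g).
Proof. by move=> sf sg; apply/smooth1_sum_of_products/SPmul. Qed.

Lemma smooth1_cst a : smooth1 (cst a).
Proof.
exists (fun n => if n is 0%N then cst a else cst 0) => // -[|n] x;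
  exact: is_derive_cst.
Qed.

Lemma smooth1D f g : smooth1 f -> smooth1 g -> smooth1 (f \+ g).
Proof.
move=> [F F0 dF] [G G0 dG]; exists (fun n => F n \+ G n) => [|n x].
  by rewrite F0 G0.
exact: is_deriveD.
Qed.

Lemma expn_expRN_le n (s : R) : 0 <= s -> s ^+ n * expR (- s) <= n`!%:R.
Proof.
move=> s0; rewrite expRN ler_pdivrMr ?expR_gt0//.
case: n => [|n]; first by rewrite expr0 mul1r; have := expR_ge1Dx s; lra.
have := expR_ge1Dxn n s0; rewrite -lerBrDl => h.
rewrite -ler_pdivrMl ?ltr0n ?fact_gt0// mulrC.
by apply: le_trans h _; rewrite gerBl.
Qed.

Lemma horner_expRN_bounded p :
  exists C, forall s : R, 0 <= s -> `|p.[s]| * expR (- s) <= C.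
Proof.
exists (\sum_(i < size p) `|p`_i| * i`!%:R) => s s0.
rewrite horner_coef (le_trans (ler_wpM2r (expR_ge0 _) (ler_norm_sum _ _ _)))//.
rewrite mulr_suml ler_sum// => i _; rewrite normrM -mulrA ler_wpM2l//.
by rewrite (ger0_norm (exprn_ge0 _ s0)) expn_expRN_le.
Qed.

Definition expNV p (t : R) : R := if 0 < t then p.[t^-1] * expR (- t^-1) else 0.

Lemma is_derive_expNV p (t : R) :
  is_derive t (1 : R) (expNV p) (expNV ('X ^+ 2 * (p - p^`())) t).
Proof.
have [t0|t0|->] := ltgtP t 0.
- have -> : expNV ('X ^+ 2 * (p - p^`())) t = 0 by rewrite /expNV ltNge (ltW t0).
  apply: (@near_eq_is_derive _ _ _ (cst 0)).
    near=> s; rewrite /expNV ltNge; suff -> : s <= 0 by [].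
    by apply/ltW; near: s; exact: lt_nbhsl.
- rewrite [X in is_derive _ _ _ X]/expNV t0.
  apply: (@near_eq_is_derive R R R (fun s : R => p.[s^-1] * expR (- s^-1))).
  + near=> s; rewrite /expNV; suff -> : 0 < s by [].
    by near: s; exact: lt_nbhsr.
  + have dV : is_derive t (1 : R) (fun s : R => s^-1) (- t ^- 2).
      apply: is_derive_eq; first by apply: is_deriveV; rewrite gt_eqF.
      by rewrite /GRing.scale /= mulr1.
    have d1 := @is_derive1_comp R (horner p) (fun s => s^-1) t _ _
      (is_derive_poly p _) dV.
    have dN := is_deriveN dV.
    have d2 := @is_derive1_comp R expR (fun s => - s^-1) t _ _ (is_derive_expR _) dN.
    have := is_deriveM d1 d2; move=> /is_derive_eq; apply.
    rewrite /GRing.scale /= hornerM hornerXn hornerD hornerN; field.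
    by rewrite gt_eqF.
- rewrite [X in is_derive _ _ _ X]/expNV ltxx.
  (* With s = 1/h, the difference quotient at 0 is h times [('X ^+ 2 * p).[s] * expR (- s)], hence
     at most [h * C] in absolute value. *)
  have [C hC] := horner_expRN_bounded ('X ^+ 2 * p).
  apply: is_derive_cvg; apply/cvgr0Pnorm_le => e e0.
  near=> h; rewrite /expNV ltxx subr0 addr0 /GRing.scale /= mulr1.
  case: ifPn => [h0|_]; last by rewrite mulr0 normr0 ltW.
  have s0 : 0 <= h^-1 by rewrite invr_ge0 ltW.
  have := hC _ s0; rewrite hornerM hornerXn normrM ger0_norm ?exprn_ge0// => hC'.
  rewrite normrM normrM (ger0_norm (expR_ge0 _)) (ger0_norm s0).
  apply: (@le_trans _ _ (h * C)).
    rewrite -ler_pdivrMl// (le_trans _ hC')// le_eqVlt; apply/orP; left.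
    by apply/eqP; ring.
  have C0 : C < `|C| + 1 by rewrite ltr_pwDr// ler_norm.
  have C1 : 0 < `|C| + 1 by rewrite ltr_pwDr.
  rewrite (le_trans (ler_wpM2l (ltW h0) (ltW C0)))// -ler_pdivlMr//.
  apply: (le_trans (ler_norm _)); apply/ltW; near: h.
  by apply: dnbhs0_lt; rewrite divr_gt0.
Unshelve. all: by end_near.
Qed.

Lemma smooth1_expNV p : smooth1 (expNV p).
Proof.
apply: (@smooth1_coind (fun f => exists q, f = expNV q)); last by exists p.
move=> _ [q ->]; exists (expNV ('X ^+ 2 * (q - q^`()))); first by eexists.
exact: is_derive_expNV.
Qed.

Lemma smooth1_continuous f : smooth1 f -> continuous f.
Proof.
move=> /smooth1_derive[g _ df] x; apply: differentiable_continuous.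
by apply/derivable1_diffP; have [] := df x.
Qed.

Lemma primitive_exists f : continuous f -> (forall t, t <= 0 -> f t = 0) ->
  exists2 F : R -> R, forall x : R, is_derive x (1 : R) F (f x) &
    forall t, t <= 0 -> F t = 0.
Proof.
move=> cf f0.
(* Starting at -1 makes every x >= 0 an interior point of the interval on which the fundamental
   theorem is applied; for x < 0 the primitive vanishes near x. *)
pose F (x : R) := \int[lebesgue_measure]_(t in `[(-1 : R), x]) f t.
have F0 t : t <= 0 -> F t = 0.
  move=> t0; rewrite /F (@eq_Rintegral _ _ _ _ _ (cst 0)).
    by rewrite Rintegral_cst ?mul0r.
  by move=> s; rewrite inE/= in_itv/= => /andP[_ st]; rewrite f0// (le_trans st).
exists F => // x; have [x0|x0] := ltP x 0.
  rewrite (f0 _ (ltW x0)).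
  apply: (@near_eq_is_derive _ _ _ (cst 0)).
  by near=> s; rewrite F0//; apply/ltW; near: s; exact: lt_nbhsl.
have [||||dF F'] := @continuous_FTC1_closed R f (-1) x (x + 1).
- by rewrite ltrDl.
- apply: continuous_compact_integrable; first exact: segment_compact.
  exact/continuous_subspaceT.
- by rewrite (lt_le_trans _ x0)// ltrN10.
- exact: cf.
by split => //; rewrite -derive1E.
Unshelve. all: by end_near. Qed.

End smooth_bump.

(** * A smooth compactly supported kernel with prescribed discrete moments *)

Section kernel.
Context {R : realType}.
Implicit Types (f g : R -> R).

Lemma is_derive_MVT f g a b : a < b ->
  (forall x : R, is_derive x (1 : R) f (g x)) ->
  exists2 c, a < c < b & f b - f a = g c * (b - a).
Proof.
move=> ab df; have [|c] := @MVT R f g a b ab (fun x _ => df x).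
  apply: continuous_subspaceT => x; apply: differentiable_continuous.
  by apply/derivable1_diffP; have [] := df x.
by rewrite in_itv /= => abc e; exists c.
Qed.

Lemma is_derive_nondecreasing f g :
  (forall x : R, is_derive x (1 : R) f (g x)) -> (forall t, 0 <= g t) ->
  {homo f : x y / x <= y}.
Proof.
move=> df g0 x y; rewrite le_eqVlt => /predU1P[->//|xy].
have [c _ e] := is_derive_MVT xy df.
by rewrite -subr_ge0 e mulr_ge0// subr_ge0 ltW.
Qed.

Lemma is_derive_diff1 f g (t : R) : (forall x : R, is_derive x (1 : R) f (g x)) ->
  exists2 c, t - 1 < c < t & f t - f (t - 1) = g c.
Proof.
move=> df; have [|c ct ->] := @is_derive_MVT f g (t - 1) t _ df.
  by rewrite gtrBl.
by exists c => //; rewrite opprB addrC subrK mulr1.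
Qed.

Lemma is_derive_shift1 f g (x : R) : (forall x : R, is_derive x (1 : R) f (g x)) ->
  is_derive x (1 : R) (fun t => f t - f (t - 1)) (g x - g (x - 1)).
Proof.
move=> df.
have d1 : is_derive x (1 : R) (fun t : R => t - 1) 1.
  by apply: is_derive_eq; rewrite ?subr0.
have dc := @is_derive1_comp R f (fun t => t - 1) x _ _ (df _) d1.
by have := is_deriveB (df x) dc; rewrite mulr1.
Qed.

Lemma smooth1_shift1 f : smooth1 f -> smooth1 (fun t => f t - f (t - 1)).
Proof.
move=> sf.
have -> : (fun t => f t - f (t - 1)) = f \+ (cst (-1) \* (fun t => f (1 * t + -1))).
  by apply/funext => t /=; rewrite mulN1r mul1r.
apply: smooth1D => //; apply: smooth1M; first exact: smooth1_cst.
exact: smooth1_affine.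
Qed.

(** A primitive of a bump supported in [0, 1], divided by its value at 1. That value is positive by
    the mean value theorem on [1/4, 3/4], where the bump is positive. *)
Lemma smooth_step_exists : exists H : R -> R,
  [/\ smooth1 H, {homo H : x y / x <= y}, forall t, t <= 0 -> H t = 0 &
      forall t, 1 <= t -> H t = 1].
Proof.
pose h := (expNV 1 : R -> R) \* (fun t => expNV 1 ((-1) * t + 1)).
have sh : smooth1 h.
  by apply: smooth1M; [|apply: smooth1_affine]; exact: smooth1_expNV.
have e0 t : 0 <= (expNV 1 t : R).
  by rewrite /expNV; case: ifP => // _; rewrite hornerC mul1r expR_ge0.
have h0 t : 0 <= h t by rewrite mulr_ge0.
have hN t : t <= 0 -> h t = 0.
  by move=> t0; rewrite /h /= {1}/expNV ltNge t0 mul0r.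
have h1 t : 1 <= t -> h t = 0.
  move=> t0; rewrite /h /= mulrC {1}/expNV ltNge.
  by rewrite mulN1r addrC subr_le0 t0 mul0r.
have [H dH HN] := primitive_exists (smooth1_continuous sh) hN.
have ndH := is_derive_nondecreasing dH h0.
have H1 : 0 < H 1.
  have [|c c01] := @is_derive_MVT H h 4^-1 (3 / 4) _ dH; first lra.
  move=> e; apply: (@lt_le_trans _ _ (H (3 / 4))); last by apply: ndH; lra.
  apply: (@le_lt_trans _ _ (H 4^-1)).
    by rewrite -(HN 0 (lexx _)); apply: ndH; lra.
  rewrite -subr_gt0 e mulr_gt0//; last lra.
  rewrite /h /= mulr_gt0// /expNV ifT ?hornerC ?mul1r ?expR_gt0//; lra.
exists (fun t => (H 1)^-1 * H t); split.
- apply: (@smooth1M _ (cst (H 1)^-1) H); first exact: smooth1_cst.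
  exact: smooth1_primitive dH.
- by move=> x y xy; rewrite ler_pM2l ?invr_gt0// ndH.
- by move=> t /HN ->; rewrite mulr0.
- move=> t; rewrite le_eqVlt => /predU1P[<-|t1]; first by rewrite mulVf ?gt_eqF.
  have [c /andP[c1 _]] := is_derive_MVT t1 dH.
  rewrite h1 ?ltW// mul0r => /eqP; rewrite subr_eq0 => /eqP ->.
  by rewrite mulVf ?gt_eqF.
Qed.

(* With [P] a second primitive of a bump, [beta] is the second difference of [P]: summation
   by parts gives the moments of [beta] and [beta'] that make sampling followed by
   interpolation with [beta] reproduce affine functions. *)
Lemma quasi_interpolation_kernel : exists beta beta' : R -> R,
  [/\ smooth1 beta, forall x : R, is_derive x (1 : R) beta (beta' x),
      forall t, 0 <= beta t,
      forall t, ~~ (0 < t < 3) -> beta t = 0 /\ beta' t = 0 &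
   forall (L : nat) (t : R),
     \sum_(m < L) `|beta' (t - m%:R)| <= 2 /\
     (2 <= t <= L%:R ->
     [/\ \sum_(m < L) beta (t - m%:R) = 1,
         \sum_(m < L) beta' (t - m%:R) = 0 &
         \sum_(m < L) m%:R * beta' (t - m%:R) = 1])].
Proof.
have [H [sH ndH H0 H1]] := smooth_step_exists.
have [P dP P0] := primitive_exists (smooth1_continuous sH) H0.
have sP := smooth1_primitive sH dP.
(* [K] is a smooth step from 0 on t <= 0 to 1 on t >= 2, with derivative [th]. Its difference [beta]
   is therefore supported in [0, 3], and the shifts of [beta] telescope to 1. *)
pose th t := H t - H (t - 1); pose K t := P t - P (t - 1).
have dK x : is_derive x (1 : R) K (th x) by exact: is_derive_shift1.
have th0 t : 0 <= th t by rewrite subr_ge0 ndH// gerBl.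
have thN t : t <= 0 -> th t = 0.
  by move=> t0; rewrite /th !H0 ?subr0// (le_trans _ t0)// gerBl.
have th2 t : 2 <= t -> th t = 0.
  by move=> t2; rewrite /th !H1 ?subrr//; lra.
have K0 t : t <= 0 -> K t = 0.
  by move=> t0; rewrite /K !P0 ?subr0// (le_trans _ t0)// gerBl.
have K2 t : 2 <= t -> K t = 1.
  move=> t2; rewrite /K; have [c /andP[ct _] ->] := is_derive_diff1 t dP.
  by rewrite H1//; lra.
have telescope (f : R -> R) L (t : R) :
    \sum_(m < L) (f (t - m%:R) - f (t - m%:R - 1)) = f t - f (t - L%:R).
  elim: L => [|L ih]; first by rewrite big_ord0 subr0 subrr.
  by rewrite big_ord_recr /= ih addrA subrK [L.+1%:R]mulrSr opprD addrA.
exists (fun t => K t - K (t - 1)), (fun t => th t - th (t - 1)); split.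
- by do 2!apply: smooth1_shift1.
- by move=> x; exact: is_derive_shift1.
- by move=> t; rewrite subr_ge0 (is_derive_nondecreasing dK)// gerBl.
- move=> t; rewrite negb_and -!leNgt => /orP[t0|t3].
    by rewrite K0// thN// K0 ?thN ?subrr//; lra.
  by rewrite K2 ?th2 ?K2 ?th2 ?subrr//; lra.
- move=> L t; split.
    (* The constant 2: [beta'] is a difference of two nonnegative values of [th], and the shifts of
       each telescope to a difference of values of [H], which is at most 1. *)
    apply: (@le_trans _ _ (\sum_(m < L) (th (t - m%:R) + th (t - 1 - m%:R)))).
      apply: ler_sum => m _; rewrite (le_trans (ler_normB _ _))//.
      by rewrite !ger0_norm// [_ - _ - _]addrAC.
    rewrite big_split /= !telescope.
    have Hb s : 0 <= H s <= 1.
      have [s0|s0] := leP s 0; first by rewrite H0// lexx ler01.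
      have [s1|s1] := leP 1 s; first by rewrite H1// lexx ler01.
      by rewrite -(H0 0)// -(H1 1)// !ndH ?ltW.
    have := Hb t; have := Hb (t - 1); have := Hb (t - L%:R).
    have := Hb (t - 1 - L%:R); lra.
  move=> /andP[t2 tL]; rewrite !telescope; split.
  + by rewrite K2// K0 ?subr0// subr_le0.
  + by rewrite th2// thN ?subr0// subr_le0.
  + have -> : \sum_(m < L) m%:R * (th (t - m%:R) - th (t - m%:R - 1)) =
        H (t - 1) - H (t - L%:R) - (L%:R - 1) * th (t - L%:R).
      elim: L {tL} => [|L ih].
        by rewrite big_ord0 subr0 /th; ring.
      have -> : t - L.+1%:R = t - L%:R - 1 by rewrite mulrSr opprD addrA.
      by rewrite big_ord_recr /= ih mulrSr /th; ring.
    by rewrite thN ?subr_le0// (H0 (t - L%:R)) ?subr_le0// H1; lra.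
Qed.
End kernel.

(** * Smooth quasi-interpolation on a grid *)

Section rV_norm.
Context {R : realType} {n : nat}.
Implicit Types x y : 'rV[R]_n.

Lemma rV_norm_leP x (c : R) : 0 <= c ->
  reflect (forall j, `|x ord0 j| <= c) (`|x| <= c).
Proof.
move=> c0; rewrite [`|x|]mx_normrE; apply: (iffP (bigmax_leP _ _ _ _)) => [[_ h] j|h].
  exact: (h (ord0, j)).
by split=> // -[i j] _; rewrite /= ord1.
Qed.

Lemma rV_norm_ltP x (c : R) : 0 < c ->
  reflect (forall j, `|x ord0 j| < c) (`|x| < c).
Proof.
move=> c0; rewrite [`|x|]mx_normrE; apply: (iffP (bigmax_ltP _ _ _ _)) => [[_ h] j|h].
  exact: (h (ord0, j)).
by split=> // -[i j] _; rewrite /= ord1.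
Qed.

Lemma coord_le_norm x j : `|x ord0 j| <= `|x|.
Proof. by have /rV_norm_leP : `|x| <= `|x| by []; exact. Qed.

End rV_norm.

(** * Smooth functions of several variables as sums of products *)

Section tensor.
Context {R : realType} {n : nat}.
Implicit Types (f g : 'rV[R]_n -> R).

(** A class closed under [partial], whose members are continuous and have all partial derivatives;
    iterating gives [smooth]. *)
Inductive sum_of_tensors : ('rV[R]_n -> R) -> Prop :=
| STprod (a : R) (b : 'I_n -> R -> R) : (forall j, smooth1 (b j)) ->
    sum_of_tensors (fun x => a * \prod_j b j (x ord0 j))
| STadd f g : sum_of_tensors f -> sum_of_tensors g -> sum_of_tensors (f \+ g)
| ST0 : sum_of_tensors (cst 0).

Lemma sum_of_tensors_continuous f : sum_of_tensors f -> continuous f.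
Proof.
elim=> {f} [a b sb|f g _ cf _ cg|] x.
- move: x; suff ct (s : seq 'I_n) :
      continuous (fun x : 'rV[R]_n => \prod_(j <- s) b j (x ord0 j)).
    by move=> x; apply: continuousM; [exact: cst_continuous|exact: ct].
  elim: s => [|j s ih] x.
    have -> : (fun x : 'rV[R]_n => \prod_(j <- [::]) b j (x ord0 j)) = cst 1.
      by apply/funext => z; rewrite big_nil.
    exact: cst_continuous.
  have -> : (fun x : 'rV[R]_n => \prod_(j <- j :: s) b j (x ord0 j)) =
      (b j \o (fun x => x ord0 j)) \* (fun x => \prod_(j <- s) b j (x ord0 j)).
    by apply/funext => z; rewrite big_cons.
  have cb : {for x, continuous (b j \o (fun y : 'rV[R]_n => y ord0 j))}.
    by apply: continuous_comp; [exact: coord_continuous|exact: smooth1_continuous].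
  by apply: continuousM; [exact: cb|exact: ih].
- by apply: continuousD; [exact: cf|exact: cg].
- exact: cst_continuous.
Qed.

Lemma is_derive_tensor (b : 'I_n -> R -> R) (k : 'I_n) (b' : R -> R) (x : 'rV[R]_n) :
  (forall t : R, is_derive t (1 : R) (b k) (b' t)) ->
  is_derive x (delta_mx ord0 k) (fun x : 'rV[R]_n => \prod_j b j (x ord0 j))
    (\prod_j (if j == k then b' else b j) (x ord0 j)).
Proof.
move=> db; apply: is_derive_cvg.
set c := \prod_(j | j != k) b j (x ord0 j).
have -> : \prod_j (if j == k then b' else b j) (x ord0 j) = b' (x ord0 k) * c.
  rewrite (bigD1 k)//= eqxx; congr (_ * _); apply: eq_bigr => j /negbTE jk.
  by rewrite jk.
have -> : (fun h : R => h^-1 *: (\prod_j b j ((h *: delta_mx ord0 k + x) ord0 j) -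
    \prod_j b j (x ord0 j))) =
    (fun h : R => (h^-1 *: (b k (h *: 1 + x ord0 k) - b k (x ord0 k))) * c).
  apply/funext => h; rewrite !(bigD1 k (P := xpredT))//= !mxE !eqxx.
  rewrite (@eq_bigr _ _ _ _ _ _ _ (fun j => b j (x ord0 j))).
    by rewrite -mulrBl /GRing.scale /= mulrA.
  by move=> j /negbTE jk; rewrite !mxE jk andbF mulr0 add0r.
apply: cvgMl; have [dbk e] := db (x ord0 k).
by rewrite -e; exact: dbk.
Qed.

Lemma sum_of_tensors_derive f k : sum_of_tensors f -> exists2 g,
  sum_of_tensors g & forall x, is_derive x (delta_mx ord0 k) f (g x).
Proof.
elim=> {f} [a b sb|f g _ [f' sf df] _ [g' sg dg]|].
- have [b' sb' db] := smooth1_derive (sb k).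
  exists (fun x => a * \prod_j (if j == k then b' else b j) (x ord0 j)); last first.
    by move=> x; apply: is_deriveZ; exact: is_derive_tensor db.
  by apply: (@STprod a (fun j => if j == k then b' else b j)) => j; case: ifP.
- exists (f' \+ g') => [|x]; first exact: STadd.
  exact: is_deriveD.
- by exists (cst 0) => [|x]; [exact: ST0|exact: is_derive_cst].
Qed.

Lemma sum_of_tensors_smooth f : sum_of_tensors f -> smooth f.
Proof.
move=> sf s; have {}sf : sum_of_tensors (foldr partial f s).
  elim: s => //= k s /(sum_of_tensors_derive k)[g sg dg].
  by have -> // : partial k (foldr partial f s) = g; apply/funext => x; have [] := dg x.
split; first exact: sum_of_tensors_continuous.
by move=> k x; have [g _ /(_ x)[]] := sum_of_tensors_derive k sf.
Qed.

Lemma sum_of_tensors_sum (I : Type) (r : seq I) (F : I -> 'rV[R]_n -> R) :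
  (forall i, sum_of_tensors (F i)) -> sum_of_tensors (fun x => \sum_(i <- r) F i x).
Proof.
move=> sF; elim: r => [|i r ih].
  by under eq_fun do rewrite big_nil; exact: ST0.
by under eq_fun do rewrite big_cons; exact: STadd.
Qed.

End tensor.

(* [psi x = sum_m W (y m) prod_j beta ((x_j + A + 2 delta) / delta - m_j)] with grid points
   [y m = delta m - (A + 2 delta)]. *)
Lemma quasi_interpolation (R : realType) (n : nat) (A delta : R) (W : 'rV[R]_n -> R) :
  0 < delta -> exists psi : 'rV[R]_n -> R,
  [/\ smooth psi,
      forall x, psi x != 0 -> exists2 y, W y != 0 & `|x - y| <= 3 * delta &
      forall x q E k, `|x| <= A ->
        (forall y, `|y - x| <= 3 * delta -> `|W y - W x - dotv q (y - x)| <= E) ->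
        `|partial k psi x - q ord0 k| <= 2 * E / delta].
Proof.
move=> d0; have [be [be' [sbe dbe be0 bes beS]]] := @quasi_interpolation_kernel R.
(* For |x_j| <= A the shift makes [(x_j + A0) / delta] at least 2, and the choice of [L] makes it at
   most [L]: this is the range in which the moment identities of the kernel hold. *)
pose A0 := A + 2 * delta.
pose L := (Num.truncn ((A + A0) / delta)).+1.
have hL (s : R) : s <= A -> (s + A0) / delta <= L%:R.
  move=> sA; apply: (@le_trans _ _ ((A + A0) / delta)).
    by rewrite ler_pM2r ?invr_gt0// lerD2r.
  by rewrite /L; apply/ltW; exact: truncnS_gt.
pose I : finType := {ffun 'I_n -> 'I_L}.
pose y (m : I) : 'rV[R]_n := \row_j (delta * (m j)%:R - A0).
pose ar (s : R) (i : 'I_L) := delta^-1 * s + (A0 / delta - i%:R).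
have arE s i : ar s i = (s + A0) / delta - i%:R by rewrite /ar; ring.
pose gam (j k : 'I_n) := if j == k then be' else be.
pose D (k : 'I_n) (x : 'rV[R]_n) (m : I) := \prod_j gam j k (ar (x ord0 j) (m j)).
pose psi (x : 'rV[R]_n) := \sum_(m : I) W (y m) * \prod_j be (ar (x ord0 j) (m j)).
have near_y (x : 'rV[R]_n) (m : I) :
    (forall j, 0 < ar (x ord0 j) (m j) < 3) -> `|x - y m| <= 3 * delta.
  move=> h; apply/rV_norm_leP => [|j]; first by rewrite mulr_ge0// ltW.
  have /andP[] := h j; rewrite arE !mxE subr_gt0 ltrBlDl.
  rewrite ltr_pdivlMr// ltr_pdivrMr// => h1 h2.
  by rewrite ler_norml; apply/andP; split; lra.
have dar (i : 'I_L) (t : R) : is_derive t (1 : R) (fun s => be (ar s i))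
    (delta^-1 * be' (ar t i)).
  have d1 : is_derive t (1 : R) (fun s : R => ar s i) delta^-1.
    by apply: is_derive_eq; rewrite /GRing.scale /= mulr1 addr0.
  by rewrite mulrC; exact: is_derive1_comp (dbe _) d1.
have sT (m : I) : sum_of_tensors (fun x => W (y m) * \prod_j be (ar (x ord0 j) (m j))).
  apply: (@STprod _ _ _ (fun j s => be (ar s (m j)))) => j.
  exact: smooth1_affine.
have dpsi k x : partial k psi x = delta^-1 * (\sum_m W (y m) * D k x m).
  have d1 (m : I) : is_derive x (delta_mx ord0 k)
      (fun x : 'rV[R]_n => \prod_j be (ar (x ord0 j) (m j))) (delta^-1 * D k x m).
    have := @is_derive_tensor R n (fun j s => be (ar s (m j))) k _ x (dar (m k)).
    move=> /is_derive_eq; apply; rewrite /D !(bigD1 k (P := xpredT))//= /gam eqxx.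
    rewrite -mulrA; congr (_ * (_ * _)).
    by apply: eq_bigr => j /negbTE ->.
  have dsum (r : seq I) : is_derive x (delta_mx ord0 k)
      (fun x : 'rV[R]_n => \sum_(m <- r) W (y m) * \prod_j be (ar (x ord0 j) (m j)))
      (\sum_(m <- r) W (y m) * (delta^-1 * D k x m)).
    elim: r => [|m r ih].
      under eq_fun do rewrite big_nil; rewrite big_nil; exact: is_derive_cst.
    under eq_fun do rewrite big_cons; rewrite big_cons.
    by apply: is_deriveD => //; exact: is_deriveZ.
  have [_ ] := dsum (index_enum I); rewrite /partial => ->.
  by rewrite mulr_sumr; apply: eq_bigr => m _; rewrite mulrCA.
exists psi; split.
- apply: sum_of_tensors_smooth; apply: sum_of_tensors_sum => m.
  exact: sT.
- move=> x psi0; apply: contrapT => nex; move/eqP : psi0; apply; apply: big1 => m _.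
  have [->|Wm] := eqVneq (W (y m)) 0; first by rewrite mul0r.
  suff [j jb] : exists j, ~~ (0 < ar (x ord0 j) (m j) < 3).
    by rewrite (bigD1 j)//= (bes _ jb).1 mul0r mulr0.
  apply: contrapT => /forallNP nj; apply: nex; exists (y m) => //.
  by apply: near_y => j; apply: contrapT => /negP /nj.
- move=> x q E k xA hE; rewrite dpsi.
  have hx j : 2 <= (x ord0 j + A0) / delta <= L%:R.
    have := le_trans (coord_le_norm x j) xA; rewrite ler_norml => /andP[x1 x2].
    by rewrite hL// andbT ler_pdivlMr// /A0; lra.
  (* A sum over the product grid factorises into sums along the axes, so the moments of [D k x] of
     orders 0 and 1 reduce to those of [be] and [be']. *)
  have sumD (c : 'I_n -> 'I_L -> R) : \sum_m D k x m * \prod_j c j (m j) =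
      \prod_j \sum_i gam j k (ar (x ord0 j) i) * c j i.
    rewrite bigA_distr_bigA; apply: eq_bigr => m _.
    by rewrite /D -big_split.
  have D1 : \sum_m D k x m = 0.
    have := sumD (fun _ _ => 1); rewrite (eq_bigr (D k x)); last first.
      by move=> m _; rewrite big1 ?mulr1.
    move=> ->; rewrite (bigD1 k)//=.
    have [_ /(_ (hx k))[_ b0 _]] := beS L ((x ord0 k + A0) / delta).
    rewrite (eq_bigr (fun i : 'I_L => be' ((x ord0 k + A0) / delta - i%:R))).
      by rewrite b0 mul0r.
    by move=> i _; rewrite mulr1 /gam eqxx arE.
  have Dl l : \sum_m D k x m * (m l)%:R = (l == k)%:R.
    have := sumD (fun j i => if j == l then i%:R else 1).
    rewrite (eq_bigr (fun m : I => D k x m * (m l)%:R)); last first.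
      by move=> m _; rewrite (bigD1 l)//= eqxx big1 ?mulr1// => j /negbTE ->.
    move=> ->; have [<-|lk] := eqVneq l k.
      rewrite big1// => j _; have [_ /(_ (hx j))[S1 _ S3]] := beS L ((x ord0 j + A0) / delta).
      rewrite /gam; case: ifP => _.
        by rewrite -[RHS]S3; apply: eq_bigr => i _; rewrite arE mulrC.
      by rewrite -[RHS]S1; apply: eq_bigr => i _; rewrite arE mulr1.
    rewrite (bigD1 k)//= eq_sym (negbTE lk).
    have [_ /(_ (hx k))[_ S2 _]] := beS L ((x ord0 k + A0) / delta).
    rewrite (eq_bigr (fun i : 'I_L => be' ((x ord0 k + A0) / delta - i%:R))).
      by rewrite S2 mul0r.
    by move=> i _; rewrite mulr1 /gam eqxx arE.
  have Dabs : \sum_m `|D k x m| <= 2.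
    rewrite (eq_bigr (fun m : I => \prod_j `|gam j k (ar (x ord0 j) (m j))|)); last first.
      by move=> m _; rewrite /D normr_prod.
    rewrite -(bigA_distr_bigA (fun j i => `|gam j k (ar (x ord0 j) i)|)).
    rewrite (bigD1 k)//= [X in _ * X]big1 ?mulr1; last first.
      move=> j /negbTE jk; have [_ /(_ (hx j))[S1 _ _]] := beS L ((x ord0 j + A0) / delta).
      rewrite -[RHS]S1; apply: eq_bigr => i _; rewrite /gam jk arE ger0_norm//.
    have [+ _] := beS L ((x ord0 k + A0) / delta); apply: le_trans.
    by apply: ler_sum => i _; rewrite /gam eqxx arE.
  (* The moments of [D k x] annihilate constants and reproduce the slope of [dotv q], so only the
     deviation of [W] from the affine function remains. *)
  have -> : delta^-1 * (\sum_m W (y m) * D k x m) - q ord0 k =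
      delta^-1 * \sum_m D k x m * (W (y m) - W x - dotv q (y m - x)).
    have -> : \sum_m D k x m * (W (y m) - W x - dotv q (y m - x)) =
        \sum_m W (y m) * D k x m - W x * (\sum_m D k x m) -
        \sum_l q ord0 l * (delta * (\sum_m D k x m * (m l)%:R) -
          (A0 + x ord0 l) * \sum_m D k x m).
      rewrite mulr_sumr -sumrB.
      under [X in _ = _ - X]eq_bigr do rewrite !mulr_sumr -sumrB mulr_sumr.
      rewrite exchange_big /= -sumrB; apply: eq_bigr => m _.
      rewrite /dotv [RHS]addrC [LHS]mulrBr [LHS]addrC; congr (_ + _); last by ring.
      rewrite mulr_sumr; congr (- _); apply: eq_bigr => l _; rewrite !mxE; ring.
    rewrite D1 mulr0 subr0 (eq_bigr (fun l => delta * (q ord0 l * (l == k)%:R))).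
      rewrite -mulr_sumr mulrBr mulKf ?gt_eqF//; congr (_ - _).
      rewrite (bigD1 k)//= eqxx mulr1 big1 ?addr0// => l /negbTE ->.
      by rewrite mulr0.
    by move=> l _; rewrite Dl mulr0 subr0; ring.
  have dV : 0 < delta^-1 by rewrite invr_gt0.
  rewrite normrM (ger0_norm (ltW dV)) [leLHS]mulrC ler_pM2r//.
  have E0 : 0 <= E.
    by apply: le_trans (hE x _); rewrite ?subrr ?normr0// mulr_ge0// ltW.
  apply: (@le_trans _ _ (\sum_m `|D k x m| * E)).
    apply: (le_trans (ler_norm_sum _ _ _)); apply: ler_sum => m _.
    have [->|Dm] := eqVneq (D k x m) 0; first by rewrite mul0r !normr0 mul0r.
    rewrite normrM ler_wpM2l// hE// distrC near_y// => j.
    apply: contraNT Dm => jb; rewrite /D (bigD1 j)//= /gam.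
    by have [b1 b2] := bes _ jb; case: ifP; rewrite ?b1 ?b2 mul0r.
  by rewrite -mulr_suml ler_wpM2r.
Qed.

(** * Integration and essentially bounded functions *)

Section junk.
Local Open Scope ereal_scope.
Context d (T : measurableType d) (R : realType).
Variable mu : {measure set T -> \bar R}.
Implicit Types (D N : set T) (f g : T -> \bar R).
Import HBNNSimple.

(** A simple function below [f] is set to zero on the null set [N]. Its integral does not change,
    and it is now below [g], since [g] is nonnegative. *)
Let le_nnintegral N f g : measurable N -> mu N = 0 -> (forall x, 0 <= g x) ->
  (forall x, ~ N x -> f x = g x) ->
  ereal_sup [set sintegral mu h | h in [set h : {nnsfun T >-> R} |
    forall x, (h x)%:E <= f x]] <=
  ereal_sup [set sintegral mu h | h in [set h : {nnsfun T >-> R} |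
    forall x, (h x)%:E <= g x]].
Proof.
move=> mN N0 g0 fg; apply/ge_ereal_sup => _ [h /= hf <-].
pose h' := proj_nnsfun h (measurableC mN).
have h'E x : h' x = (h \_ (~` N)) x by rewrite (mrestrict h (measurableC mN)).
have -> : sintegral mu h = sintegral mu h'.
  have sE (k : {nnsfun T >-> R}) : sintegral mu k = \int[mu]_x (k x)%:E.
    by rewrite integral_nnsfun// patch_setT.
  rewrite !sE; apply: ae_eq_integral => //.
  - exact/measurable_EFinP.
  - exact/measurable_EFinP.
  - exists N; split => // x /=; apply: contra_notP => nNx _.
    by rewrite -[X in _ = X%:E]/(h' x) h'E patchE mem_set.
apply: ereal_sup_ubound; exists h' => // x; rewrite /= -[X in X%:E]/(h' x) h'E patchE.
have [Nx|nNx] := pselect (N x).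
  by rewrite memNset//=; apply.
by rewrite mem_set// -fg.
Qed.

(* No measurability is assumed: on the faces of the cells the partial derivatives of
   finite element functions take junk values. *)
Lemma ae_eq_integral_junk D f g :
  {ae mu, forall x, D x -> f x = g x} ->
  \int[mu]_(x in D) f x = \int[mu]_(x in D) g x.
Proof.
move=> [N [mN N0 hN]].
have fgN x : ~ N x -> (f \_ D) x = (g \_ D) x.
  move=> nNx; rewrite !patchE; case: ifPn => // /set_mem Dx.
  by apply: contrapT => fg; apply: nNx; apply: hN => /= /(_ Dx).
rewrite /integral; congr (_ - _); apply/eqP; rewrite eq_le; apply/andP; split;
  apply: (le_nnintegral mN N0) => [x|x nNx];
  by rewrite ?funeposE ?funenegE ?le_max ?lexx ?orbT// fgN.
Qed.

End junk.

Section essentially_bounded.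
Context d (T : measurableType d) (R : realType).
Variables (mu : {measure set T -> \bar R}) (D : set T).
Hypotheses (mD : measurable D) (D_fin : (mu D < +oo)%E).
Implicit Types f g : T -> R.

Lemma ae_eq_Rintegral f g : {ae mu, forall x, D x -> f x = g x} ->
  \int[mu]_(x in D) f x = \int[mu]_(x in D) g x.
Proof.
move=> fg; congr fine; apply: ae_eq_integral_junk.
by apply: filterS fg => x fg Dx; rewrite fg.
Qed.

(** Should the integral be infinite, [fine] returns 0, which has the right sign as well. The same
    holds for the opposite sign. *)
Lemma Rintegral_ae_ge0 f : {ae mu, forall x, D x -> 0 <= f x} ->
  0 <= \int[mu]_(x in D) f x.
Proof.
move=> f0; rewrite (@ae_eq_Rintegral _ (fun x => `|f x|)); first exact: Rintegral_ge0.
by apply: filterS f0 => x f0 Dx; rewrite ger0_norm// f0.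
Qed.

Lemma Rintegral_ae_le0 f : {ae mu, forall x, D x -> f x <= 0} ->
  \int[mu]_(x in D) f x <= 0.
Proof.
move=> f0; rewrite (@ae_eq_Rintegral _ (fun x => - `|f x|)); last first.
  by apply: filterS f0 => x f0 Dx; rewrite ler0_norm ?opprK ?f0.
pose h x := - `|f x|; have e : (\int[mu]_(x in D) ((EFin \o h) ^\+ x) = 0)%E.
  apply: integral0_eq => x _; rewrite funeposE /=; apply/max_idPr.
  by rewrite lee_fin /h oppr_le0.
by rewrite /Rintegral fine_le0// integralE e sub0e oppe_le0 integral_ge0.
Qed.

(** The integrands contain classical partial derivatives, which are uncontrolled on the faces of the
    cells; measurability and the bound are therefore imposed on a representative. *)
Definition ess_bounded f := exists2 f' : T -> R, measurable_fun setT f' /\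
  (exists K, forall x, `|f' x| <= K) & {ae mu, forall x, D x -> f x = f' x}.

Lemma ess_bounded_ae f g : {ae mu, forall x, D x -> f x = g x} ->
  ess_bounded f -> ess_bounded g.
Proof.
move=> fg [f' mf' ff']; exists f' => //; apply: filterS2 fg ff' => x fg ff' Dx.
by rewrite -fg// ff'.
Qed.

Lemma ess_boundedD f g : ess_bounded f -> ess_bounded g -> ess_bounded (fun x => f x + g x).
Proof.
move=> [f' [mf [K hK]] ff] [g' [mg [L hL]] gg]; exists (f' \+ g').
  split; first exact: measurable_funD.
  by exists (K + L) => x; rewrite (le_trans (ler_normD _ _))// lerD.
by apply: filterS2 ff gg => x ff gg Dx /=; rewrite ff// gg.
Qed.

Lemma ess_boundedM f g : ess_bounded f -> ess_bounded g -> ess_bounded (fun x => f x * g x).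
Proof.
move=> [f' [mf [K hK]] ff] [g' [mg [L hL]] gg]; exists (f' \* g').
  split; first exact: measurable_funM.
  by exists (K * L) => x; rewrite normrM ler_pM.
by apply: filterS2 ff gg => x ff gg Dx /=; rewrite ff// gg.
Qed.

Lemma ess_bounded_cst a : ess_bounded (fun=> a).
Proof.
exists (cst a); first by split; [exact: measurable_cst|exists `|a| => ?].
exact: aeW.
Qed.

Lemma ess_bounded_sum (I : Type) (r : seq I) (P : pred I) (F : I -> T -> R) :
  (forall i, P i -> ess_bounded (F i)) -> ess_bounded (fun x => \sum_(i <- r | P i) F i x).
Proof.
move=> bF; elim: r => [|i r ih].
  under eq_fun do rewrite big_nil; exact: ess_bounded_cst.
under eq_fun do rewrite big_cons; case: (boolP (P i)) => // Pi.
by apply: ess_boundedD => //; exact: bF.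
Qed.

Let bounded_integrable f K : measurable_fun setT f -> (forall x, `|f x| <= K) ->
  mu.-integrable D (EFin \o f).
Proof.
move=> mf hK; apply: (@measurable_bounded_integrable) => //.
  exact: measurable_funTS.
exists K; split; first exact: num_real.
by move=> M KM x _ /=; rewrite (le_trans (hK x))// ltW.
Qed.

Lemma RintegralD_ess f g : ess_bounded f -> ess_bounded g ->
  \int[mu]_(x in D) (f x + g x) = \int[mu]_(x in D) f x + \int[mu]_(x in D) g x.
Proof.
move=> [f' [mf [K hK]] ff] [g' [mg [L hL]] gg].
rewrite (ae_eq_Rintegral ff) (ae_eq_Rintegral gg) -RintegralD//.
- by apply: ae_eq_Rintegral; apply: filterS2 ff gg => x ff gg Dx /=; rewrite ff// gg.
- exact: bounded_integrable hK.
- exact: bounded_integrable hL.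
Qed.

Lemma RintegralZl_ess a f : ess_bounded f ->
  \int[mu]_(x in D) (a * f x) = a * \int[mu]_(x in D) f x.
Proof.
move=> [f' [mf [K hK]] ff]; rewrite (ae_eq_Rintegral ff) -RintegralZl//.
- by apply: ae_eq_Rintegral; apply: filterS ff => x ff Dx /=; rewrite ff.
- exact: bounded_integrable hK.
Qed.

Lemma Rintegral_sum_ess (I : Type) (r : seq I) (P : pred I) (F : I -> T -> R) :
  (forall i, P i -> ess_bounded (F i)) ->
  \int[mu]_(x in D) (\sum_(i <- r | P i) F i x) =
  \sum_(i <- r | P i) \int[mu]_(x in D) F i x.
Proof.
move=> bF; elim: r => [|i r ih].
  under eq_Rintegral do rewrite big_nil.
  by rewrite big_nil Rintegral_cst// mul0r.
under eq_Rintegral do rewrite big_cons; rewrite big_cons.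
case: (boolP (P i)) => // Pi; rewrite RintegralD_ess ?ih//; first exact: bF.
exact: ess_bounded_sum.
Qed.

Lemma bounded_convergence0 (f_ : nat -> T -> R) f K :
  (forall n, ess_bounded (f_ n)) -> ess_bounded f ->
  (forall n, {ae mu, forall x, D x -> `|f_ n x| <= K}) ->
  {ae mu, forall x, D x -> f_ n x @[n --> \oo] --> f x} ->
  (forall n, \int[mu]_(x in D) f_ n x = 0) -> \int[mu]_(x in D) f x = 0.
Proof.
move=> bf_ [f' [mf' _] ff] hK f_f f_0.
have /choice[g_ hg_] : forall n, exists g_ : T -> R, measurable_fun setT g_ /\
    {ae mu, forall x, D x -> f_ n x = g_ x}.
  by move=> n; have [g [mg _] fg] := bf_ n; exists g.
have /ae_foralln hg : forall n, {ae mu, forall x, D x -> f_ n x = g_ n x}.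
  by move=> n; have [] := hg_ n.
have /ae_foralln {}hK := hK.
have mg n : measurable_fun D (EFin \o g_ n).
  by apply/measurable_EFinP/measurable_funTS; have [] := hg_ n.
have mf : measurable_fun D (EFin \o f').
  exact/measurable_EFinP/measurable_funTS.
have [|||_ _] := @dominated_convergence _ T R mu D mD (fun n => EFin \o g_ n)
  (EFin \o f') (cst K%:E) mg mf.
- apply: filterS3 f_f hg ff => x f_f hg ff Dx; apply: cvg_EFin; first exact: nearW.
  rewrite -(ff Dx); have := f_f Dx; apply: cvg_trans; apply: near_eq_cvg.
  by apply: nearW => n /=; rewrite hg.
- exact: (@bounded_integrable (cst K) `|K|).
- apply: filterS2 hK hg => x hK hg n Dx /=.
  by rewrite lee_fin -hg// hK.
rewrite (ae_eq_Rintegral ff) /Rintegral => h.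
(* A real integral equal to 0 could also stem from an infinite one. The bounded representative [gn]
   excludes this, and the extended integrals vanish. *)
have g0 n : (\int[mu]_(x in D) (g_ n x)%:E = 0)%E.
  have [gn [mgn [M hM]] fgn] := bf_ n.
  rewrite -(@ae_eq_integral_junk _ _ _ mu D (EFin \o f_ n)); last first.
    by apply: filterS hg => x hg Dx /=; rewrite hg.
  have e := @ae_eq_integral_junk _ _ _ mu D (EFin \o f_ n) (EFin \o gn).
  have := f_0 n; rewrite /Rintegral e; last first.
    by apply: filterS fgn => x fgn Dx /=; rewrite fgn.
  move=> fine0; rewrite -[LHS]fineK ?fine0//.
  exact/integrable_fin_num/(bounded_integrable mgn hM).
have {}h : cst 0%E @ \oo --> (\int[mu]_(x in D) (f' x)%:E)%E.
  apply: cvg_trans h; apply: near_eq_cvg; apply: nearW => n /=.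
  by rewrite g0.
by rewrite -(cvg_unique _ (cvg_cst _) h).
Qed.

End essentially_bounded.

(** * Lebesgue measure on row vectors *)

Section lebesgue_rV_facts.
Context {R : realType}.

Lemma measurable_rV_cylinder n (A : 'I_n -> set R) :
  (forall i, measurable (A i : set (measurableTypeR R))) ->
  measurable [set x : 'rV[R]_n | forall i, A i (x ord0 i)].
Proof.
move=> mA.
rewrite (_ : mkset _ = \bigcap_(i in [set: 'I_n]) (rV_coord i @^-1` A i)); last first.
  by apply/seteqP; split => x /= => [h i _|h i]; [exact: h|exact: h].
apply: fin_bigcap_measurable => // i _.
by rewrite -[X in measurable X]setTI; apply: measurable_rV_coord.
Qed.

(** An open set is the union of the boxes with rational centre and radius 1/(m+1) that it contains;
    [F] enumerates them. *)
Lemma measurable_rV_open n (A : set 'rV[R]_n) : open A -> measurable A.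
Proof.
move=> oA.
pose box (c : 'rV[rat]_n) (m : nat) : set 'rV[R]_n :=
  [set y | forall j, `](ratr (c ord0 j) - m.+1%:R^-1), (ratr (c ord0 j) + m.+1%:R^-1)[%classic
    (y ord0 j)].
pose F k : set 'rV[R]_n := if unpickle k is Some cm then
  (if pselect (box cm.1 cm.2 `<=` A) then box cm.1 cm.2 else set0) else set0.
have -> : A = \bigcup_k F k.
  apply/seteqP; split => [x Ax|x [k _]]; last first.
    by rewrite /F; case: unpickle => // cm; case: pselect => // bA; exact: bA.
  have /nbhs_ballP[e /= e0 xeA] := open_nbhs_nbhs (conj oA Ax).
  pose m := Num.truncn (2 / e).
  have me : m.+1%:R^-1 < e / 2.
    rewrite -[e / 2]invrK ltf_pV2 ?posrE ?invr_gt0 ?divr_gt0// invf_div.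
    exact: truncnS_gt.
  have m0 : 0 < m.+1%:R^-1 :> R by rewrite invr_gt0.
  have /choice[c hc] : forall j, exists q : rat,
      (ratr q : R) \in `](x ord0 j - m.+1%:R^-1), (x ord0 j + m.+1%:R^-1)[.
    by move=> j; apply: rat_in_itvoo; rewrite ltrD2l gtrN.
  exists (pickle (\row_j c j, m)) => //; rewrite /F pickleK /=.
  have cx : box (\row_j c j) m x.
    move=> j; have := hc j; rewrite /= !in_itv /= mxE => /andP[].
    by move: m.+1%:R^-1 => z h1 h2; apply/andP; split; lra.
  case: pselect => // nbA; exfalso; apply: nbA => y yc; apply: xeA.
  rewrite -ball_normE /=; apply/rV_norm_ltP => // j.
  have := yc j; have := cx j; rewrite /= !in_itv/= !mxE => /andP[+ +] /andP[].
  move: m.+1%:R^-1 me => z me h1 h2 h3 h4.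
  by rewrite ltr_norml; apply/andP; split; lra.
apply: bigcup_measurable => k _; rewrite /F; case: unpickle => // cm.
case: pselect => ? //=.
exact: (@measurable_rV_cylinder n (fun j =>
  `](ratr (cm.1 ord0 j) - cm.2.+1%:R^-1), (ratr (cm.1 ord0 j) + cm.2.+1%:R^-1)[%classic)).
Qed.

Lemma measurable_dotv n (q : 'rV[R]_n) (r : R) :
  measurable_fun setT (fun y : 'rV[R]_n => dotv q y + r).
Proof.
apply: measurable_funD; last exact: measurable_cst.
apply: measurable_sum => k.
by apply: measurable_funM; [exact: measurable_cst|exact: measurable_rV_coord].
Qed.

(** Induction along the product structure of the measure. If a later coordinate of [q] is nonzero,
    every section at a fixed first coordinate is null by induction; otherwise the set is empty or
    the product of a single point with the whole space. *)
Lemma lebesgue_rV_hyperplane n (q : 'rV[R]_n) (r : R) : (q != 0) || (r != 0) ->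
  lebesgue_rV n [set y | dotv q y + r = 0] = 0%E.
Proof.
elim: n q r => [|n ih] q r qr0.
  rewrite /= diracE memNset//= /dotv big_ord0 add0r => r0; move: qr0.
  by rewrite r0 eqxx orbF => /eqP; apply; apply/rowP => -[].
pose q' := \row_j q ord0 (lift ord0 j).
have dotS a x : dotv q (cons_rV (a, x)) + r = dotv q' x + (q ord0 ord0 * a + r).
  rewrite /dotv big_ord_recl cons_rV0 addrAC [RHS]addrC; congr (_ + _).
  by apply: eq_bigr => i _; rewrite cons_rVS mxE.
rewrite /= /lebesgue_rV_step /pushforward.
set B := _ @^-1` _.
have mB : measurable B.
  rewrite -[X in measurable X]setTI; apply: measurable_cons_rV => //.
  have -> : [set y | dotv q y + r = 0] = setT `&` (fun y => dotv q y + r) @^-1` [set 0].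
    by rewrite setTI.
  exact: measurable_dotv.
have [q'0|q'0] := eqVneq q' 0; last first.
  rewrite /product_measure1; apply: integral0_eq => a _ /=.
  rewrite -[RHS](ih q' (q ord0 ord0 * a + r)) ?q'0//; congr (lebesgue_rV _ _).
  by apply/seteqP; split => x; rewrite /xsection /= inE /B /= dotS.
have B' a x : B (a, x) = (q ord0 ord0 * a + r = 0).
  by rewrite /B /= dotS q'0 /dotv big1 ?add0r// => i _; rewrite mxE mul0r.
have [q0|q0] := eqVneq (q ord0 ord0) 0.
  rewrite (_ : B = set0) ?measure0//; apply/seteqP; split => // -[a x].
  rewrite B' q0 mul0r add0r => r0; move: qr0; rewrite r0 eqxx orbF => /eqP; apply.
  apply/rowP => j; rewrite mxE; case: (unliftP ord0 j) => [i ->|-> //].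
  by have := congr1 (fun u : 'rV_n => u ord0 i) q'0; rewrite !mxE.
rewrite (_ : B = [set - r / q ord0 ord0] `*` setT).
  rewrite [LHS]product_measure1E// (_ : _ [set _] = 0%E) ?mul0e//.
  exact: lebesgue_measure_set1.
apply/seteqP; split => -[a x]; rewrite B' /=.
  move=> /eqP; rewrite addr_eq0 => /eqP e; split=> //=.
  by rewrite -e mulrAC divff// mul1r.
by move=> [-> _]; rewrite mulrC divfK// addNr.
Qed.

Lemma lebesgue_rV_ball n (x : 'rV[R]_n) (e : R) : 0 < e ->
  lebesgue_rV n (ball x e) = ((2 * e) ^+ n)%:E.
Proof.
move=> e0.
have -> : ball x e =
    [set y : 'rV[R]_n | forall j, `](x ord0 j - e), (x ord0 j + e)[%classic (y ord0 j)].
  apply/seteqP; split => y; rewrite -ball_normE /= => h.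
    move/(rV_norm_ltP _ e0) : h => h j; have := h j.
    rewrite !mxE in_itv/= ltr_norml => /andP[h1 h2].
    by apply/andP; split; lra.
  apply/rV_norm_ltP => // j; have := h j.
  rewrite in_itv/= !mxE ltr_norml => /andP[h1 h2].
  by apply/andP; split; lra.
rewrite (@lebesgue_rV_box _ n
  (fun j => `](x ord0 j - e), (x ord0 j + e)[%classic)) => [|j]; last exact: measurable_itv.
rewrite (eq_bigr (fun=> (2 * e)%:E)) => [|j _]; last first.
  rewrite [LHS]lebesgue_measure_itv /= lte_fin.
  have -> : x ord0 j - e < x ord0 j + e by lra.
  by rewrite -EFinB; congr _%:E; ring.
elim: n {x} => [|n ih]; first by rewrite big_ord0 expr0.
by rewrite big_ord_recl exprS EFinM ih.
Qed.

Lemma lebesgue_rV_open_gt0 n (A : set 'rV[R]_n) : open A -> A !=set0 ->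
  (0 < lebesgue_rV n A)%E.
Proof.
move=> oA [x Ax]; have /nbhs_ballP[e /= e0 xeA] := open_nbhs_nbhs (conj oA Ax).
apply: (@lt_le_trans _ _ (lebesgue_rV n (ball x e))).
  by rewrite lebesgue_rV_ball// lte_fin exprn_gt0// mulr_gt0.
apply: le_measure => //; rewrite inE; last exact: measurable_rV_open.
by apply: measurable_rV_open; exact: ball_open.
Qed.

Lemma lebesgue_rV_bounded n (A : set 'rV[R]_n) (K : R) : measurable A ->
  (forall x, A x -> `|x| < K) -> (lebesgue_rV n A < +oo)%E.
Proof.
move=> mA hK; have [->|/set0P[x Ax]] := eqVneq A set0; first by rewrite measure0.
have K0 : 0 < K by apply: le_lt_trans (hK x Ax).
apply: (@le_lt_trans _ _ (lebesgue_rV n (ball 0 K))); last first.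
  by rewrite lebesgue_rV_ball// ltry.
apply: le_measure; rewrite ?inE//; first by apply: measurable_rV_open; exact: ball_open.
by move=> y /hK; rewrite -ball_normE /= sub0r normrN.
Qed.

End lebesgue_rV_facts.

(** The representative is [f \_ Omega] clipped to [-|K|, |K|], where [K] is an essential bound. *)
Lemma Lp_oo_ess_bounded (R : realType) n (Omega : set 'rV[R]_n) (f : 'rV[R]_n -> R) :
  measurable Omega -> Lp_space Omega +oo f -> ess_bounded (lebesgue_rV n) Omega f.
Proof.
move=> mO [mf]; rewrite /finite_norm unlock.
have -> : (0 < lebesgue_rV n [set: 'rV[R]_n])%E.
  by apply: lebesgue_rV_open_gt0; [exact: openT|exists 0].
rewrite /ess_sup => /ereal_inf_lt[k /= hk koo].
pose K := fine k; pose h := f \_ Omega.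
exists (fun x => Num.max (- `|K|) (Num.min `|K| (h x))).
  split.
    apply: measurable_maxr; first exact: measurable_cst.
    apply: measurable_minr; first exact: measurable_cst.
    by apply/(measurable_restrictT _ _).1.
  exists `|K| => x; rewrite ler_norml.
  rewrite le_max lexx /= ge_max ge_min lexx /= andbT.
  by rewrite (le_trans _ (normr_ge0 K))// oppr_le0.
apply: filterS hk => x hk Ox.
have hx : h x = f x by rewrite /h patchE mem_set.
have fK : `|f x| <= `|K|.
  move: hk; rewrite /= -/h hx /K; case: (k) koo => [s _||]//=.
  by rewrite lee_fin => /le_trans; apply; exact: ler_norm.
move: fK; rewrite ler_norml => /andP[f1 f2].
by rewrite hx (min_idPr f2) (max_idPr f1).
Qed.

(** * Affine functions and barycentric coordinates *)

Section dotv.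
Context {R : realType} {d : nat}.
Implicit Types q x y : 'rV[R]_d.

Lemma dotvDr q x y : dotv q (x + y) = dotv q x + dotv q y.
Proof. by rewrite /dotv -big_split; apply: eq_bigr => k _; rewrite mxE mulrDr. Qed.

Lemma dotvZr q (a : R) x : dotv q (a *: x) = a * dotv q x.
Proof. by rewrite /dotv mulr_sumr; apply: eq_bigr => k _; rewrite mxE mulrCA. Qed.

Lemma dotvDl q x y : dotv (x + y) q = dotv x q + dotv y q.
Proof. by rewrite /dotv -big_split; apply: eq_bigr => k _; rewrite mxE mulrDl. Qed.

Lemma dotvZl q (a : R) x : dotv (a *: x) q = a * dotv x q.
Proof. by rewrite /dotv mulr_sumr; apply: eq_bigr => k _; rewrite mxE mulrA. Qed.

Lemma dotv0r q : dotv q 0 = 0.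
Proof. by rewrite -(scale0r 0) dotvZr mul0r. Qed.

Lemma dotv0l q : dotv 0 q = 0.
Proof. by rewrite -(scale0r 0) dotvZl mul0r. Qed.

Lemma dotv_sumr (I : finType) (P : pred I) q (F : I -> 'rV[R]_d) :
  dotv q (\sum_(i | P i) F i) = \sum_(i | P i) dotv q (F i).
Proof. by elim/big_rec2 : _ => [|i y1 y2 _ <-]; [exact: dotv0r|exact: dotvDr]. Qed.

Lemma dotv_suml (I : finType) (P : pred I) q (F : I -> 'rV[R]_d) :
  dotv (\sum_(i | P i) F i) q = \sum_(i | P i) dotv (F i) q.
Proof. by elim/big_rec2 : _ => [|i y1 y2 _ <-]; [exact: dotv0l|exact: dotvDl]. Qed.

Lemma dotv_delta q (k : 'I_d) : dotv q (delta_mx ord0 k) = q ord0 k.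
Proof.
rewrite /dotv (bigD1 k)//= !mxE !eqxx mulr1 big1 ?addr0// => j /negbTE jk.
by rewrite mxE jk andbF mulr0.
Qed.

Lemma dotv_le_norm q x : `|dotv q x| <= (\sum_k `|q ord0 k|) * `|x|.
Proof.
rewrite mulr_suml (le_trans (ler_norm_sum _ _ _))// ler_sum// => k _.
by rewrite normrM ler_wpM2l// coord_le_norm.
Qed.

Lemma dotv_continuous q : continuous (dotv q).
Proof.
move=> x; apply: continuous_big => [[y z]|k _ z]; first exact: add_continuous.
by apply: continuousM; [exact: cst_continuous|exact: coord_continuous].
Qed.

End dotv.

Lemma mulmx1C_eq (R : comNzRingType) m n (A : 'M[R]_(m, n)) (B : 'M[R]_(n, m)) :
  m = n -> A *m B = 1%:M -> B *m A = 1%:M.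
Proof. by move=> mn; case: _ / mn B A => B A; exact: mulmx1C. Qed.

Section hull.
Context {R : realType} {d : nat} {I : finType}.
Variables (p : I -> 'rV[R]_d).

Lemma hull_vertex (T : {set I}) i : i \in T -> hull p T (p i).
Proof.
move=> iT; exists (fun j => (j == i)%:R); split.
- by move=> j _; rewrite ler0n.
- by rewrite (bigD1 i)//= eqxx big1 ?addr0// => j /andP[_ /negbTE ->].
- rewrite (bigD1 i)//= eqxx scale1r big1 ?addr0// => j /andP[_ /negbTE ->].
  by rewrite scale0r.
Qed.

Variables (gr : I -> 'rV[R]_d) (cs : I -> R) (T : {set I}).
Local Notation lam i y := (dotv (gr i) y + cs i).
Hypothesis lam_vertex : forall i j, j \in T -> lam i (p j) = (i == j)%:R.
Hypothesis card_T : #|T| = d.+1.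

Lemma affine_comb (w : I -> R) i : \sum_(j in T) w j = 1 ->
  lam i (\sum_(j in T) w j *: p j) = \sum_(j in T) w j * lam i (p j).
Proof.
move=> w1; rewrite dotv_sumr -[X in _ + X]mul1r -w1 mulr_suml -big_split.
by apply: eq_bigr => j _; rewrite /= dotvZr mulrDr.
Qed.

(** The matrix [P] of vertices and the matrix [Q] of coefficients satisfy [P *m Q = 1%:M], which is
    duality at the vertices. Both are square because [T] has d+1 elements, so [Q *m P = 1%:M], and
    this contains the two identities. *)
Lemma barycentric y :
  \sum_(i in T) lam i y = 1 /\ \sum_(i in T) lam i y *: p i = y.
Proof.
pose e (k : 'I_#|T|) := enum_val k.
pose P : 'M[R]_(#|T|, d.+1) := \matrix_(k, j)
  if unlift ord0 j is Some i then p (e k) ord0 i else 1.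
pose Q : 'M[R]_(d.+1, #|T|) := \matrix_(j, k)
  if unlift ord0 j is Some i then gr (e k) ord0 i else cs (e k).
have PQ : P *m Q = 1%:M.
  apply/matrixP => k l; rewrite !mxE big_ord_recl !mxE unlift_none mul1r.
  have := lam_vertex (e l) (enum_valP k).
  rewrite (inj_eq enum_val_inj) eq_sym => <-; rewrite addrC; congr (_ + _).
  by apply: eq_bigr => i _; rewrite !mxE liftK mulrC.
have QP := mulmx1C_eq card_T PQ.
pose v : 'rV[R]_d.+1 := \row_j if unlift ord0 j is Some i then y ord0 i else 1.
have vQ k : (v *m Q) ord0 k = lam (e k) y.
  rewrite !mxE big_ord_recl !mxE unlift_none mul1r addrC; congr (_ + _).
  by apply: eq_bigr => i _; rewrite !mxE liftK mulrC.
have vQP j : (v *m Q *m P) ord0 j = v ord0 j by rewrite -mulmxA QP mulmx1.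
split.
- have := vQP ord0; rewrite mxE [in RHS]mxE unlift_none => <-.
  by rewrite big_enum_val; apply: eq_bigr => k _; rewrite vQ mxE unlift_none mulr1.
- apply/rowP => j; have := vQP (lift ord0 j); rewrite mxE [in RHS]mxE liftK => <-.
  rewrite big_enum_val summxE; apply: eq_bigr => k _.
  by rewrite vQ !mxE liftK.
Qed.

Lemma lam_notin i y : i \notin T -> lam i y = 0.
Proof.
move=> iT; have [w1 wy] := barycentric y.
rewrite -{1}wy affine_comb// big1// => j jT; rewrite lam_vertex//.
by case: eqVneq iT => [->|_ _]; rewrite ?jT ?mulr0.
Qed.

Lemma hullP y : hull p T y <-> forall i, i \in T -> 0 <= lam i y.
Proof.
split=> [[w [w0 w1 ->]] i iT|h].
  rewrite affine_comb// (bigD1 i)//= lam_vertex// eqxx mulr1 big1 ?addr0 ?w0//.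
  by move=> j /andP[jT /negbTE ji]; rewrite lam_vertex// eq_sym ji mulr0.
by have [w1 wy] := barycentric y; exists (fun i => lam i y).
Qed.

Lemma lam_line i j t y : j \in T ->
  lam i (p j + t *: (y - p j)) = (1 - t) * (i == j)%:R + t * lam i y.
Proof.
move=> jT; rewrite -(lam_vertex i jT) dotvDr dotvZr -scaleN1r dotvDr dotvZr; ring.
Qed.

End hull.

Lemma dotvC (R : realType) d (x y : 'rV[R]_d) : dotv x y = dotv y x.
Proof. by rewrite /dotv; apply: eq_bigr => k _; rewrite mulrC. Qed.

Lemma norm_lipschitz_continuous (R : realType) (V : normedModType R) (f : V -> R) (L : R) :
  (forall x y, `|f x - f y| <= L * `|x - y|) -> continuous f.
Proof.
move=> fL x; apply/cvgrPdist_lt => e e0.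
have L1 : 0 < `|L| + 1 by rewrite ltr_pwDr.
near=> y; apply: le_lt_trans (fL _ _) _.
apply: (@le_lt_trans _ _ ((`|L| + 1) * `|x - y|)).
  by rewrite ler_wpM2r// (le_trans (ler_norm _))// lerDl.
rewrite -ltr_pdivlMl// mulrC; near: y.
by apply: cvgr_dist_lt => //; exact: divr_gt0.
Unshelve. all: by end_near. Qed.

(** The domain lies on one side of its boundary. At a boundary point [x] outside of [Omega] the
    height [gam 0] is at most 0, so x + s n with small s > 0 has a neighbourhood above the graph and
    cannot belong to the closure. *)
Lemma lipschitz_boundary_regular (R : realType) d (Omega : set 'rV[R]_d) :
  open Omega -> lipschitz_boundary Omega -> (closure Omega)° `<=` Omega.
Proof.
move=> oO hlip x xi; apply: contrapT => nOx.
have bx : boundary Omega x.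
  by split; [exact: interior_subset|rewrite (interior_id Omega).1].
have [n [r [h [gam [n1 r0 h0 lg [_ hO]]]]]] := hlip x bx.
have orth0 s : orth_proj n (s *: n) = 0.
  by rewrite /orth_proj dotvC dotvZr n1 mulr1 subrr.
have dotn s : dotv (s *: n) n = s by rewrite dotvZl n1 mulr1.
have cgam : continuous gam.
  have [M [_ hM]] := lg; apply: (@norm_lipschitz_continuous _ _ _ (M + 1)) => y z.
  by apply: (hM (M + 1) _ (y, z)) => //; rewrite ltrDl.
have cdot : continuous (fun y => dotv y n).
  have -> : (fun y => dotv y n) = dotv n by apply/funext => y; exact: dotvC.
  exact: dotv_continuous.
have corth : continuous (orth_proj n).
  move=> y; have c1 : {for y, continuous (fun z => dotv z n *: n)}.
    by apply: continuousZr_tmp; exact: cdot.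
  by have := continuousB (@cvg_id _ (nbhs y)) c1.
have gam0 : gam 0 <= 0.
  rewrite leNgt; apply/negP => g0; apply: nOx; rewrite -[x]addr0 -(scale0r n).
  by apply/hO; rewrite ?orth0 ?dotn ?normr0.
have near_int : \forall s \near (0 : R)^'+, (closure Omega)° (x + s *: n).
  have cl : {for (0 : R), continuous (fun s : R => x + s *: n)}.
    apply: continuousD; first exact: cst_continuous.
    by apply: continuousZr_tmp; exact: cvg_id.
  have : \forall s \near (0 : R), (closure Omega)° (x + s *: n).
    by apply: cl; rewrite scale0r addr0; apply: open_nbhs_nbhs; split => //; exact: open_interior.
  by rewrite near_withinE; apply: filterS => s ? _.
near (0 : R)^'+ => s.
have s0 : 0 < s by [].
have sh : s < h by near: s; exact: nbhs_right_lt.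
have clO : closure Omega (x + s *: n) by apply: interior_subset; near: s.
have far : \forall y \near s *: n, ~ Omega (x + y).
  near=> y; rewrite hO; [| |].
  - apply/negP; rewrite -leNgt -subr_ge0; apply/ltW; near: y.
    have cc : {for s *: n, continuous (fun y => dotv y n - gam (orth_proj n y))}.
      apply: continuousB; first exact: cdot.
      by apply: continuous_comp; [exact: corth|exact: cgam].
    apply: (cvgr_gt _ cc); rewrite orth0 dotn subr_gt0.
    exact: le_lt_trans s0.
  - near: y; have cc : {for s *: n, continuous (fun y => `|orth_proj n y|)}.
      by apply: continuous_comp; [exact: corth|exact: norm_continuous].
    by apply: (cvgr_lt _ cc); rewrite orth0 normr0.
  - near: y; have cc : {for s *: n, continuous (fun y => `|dotv y n|)}.
      by apply: continuous_comp; [exact: cdot|exact: norm_continuous].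
    by apply: (cvgr_lt _ cc); rewrite dotn gtr0_norm.
have [e /= e0 he] := (nbhs_ballP _ _).1 far.
have [z [Oz]] := clO _ (nbhsx_ballx (x + s *: n) e e0).
rewrite -ball_normE /= => ze.
have := he (z - x); rewrite [x + _]addrC subrK; apply => //.
by rewrite -ball_normE /= opprB addrA [_ + x]addrC.
Unshelve. all: by end_near.
Qed.

(** * Lipschitz estimates *)

Section pointwise_lipschitz.
Context {R : realType}.

(** Continuous induction: the bound holds up to the supremum of [E], and the local estimate at the
    supremum carries it further unless the supremum is 1. *)
Lemma pointwise_lipschitz_segment (F : R -> R) (c : R) : 0 <= c ->
  (forall t, \forall s \near t, `|F s - F t| <= c * `|s - t|) -> `|F 1 - F 0| <= c.
Proof.
move=> c0 Fl.
pose E : set R := [set t | 0 <= t <= 1 /\ forall s, 0 <= s <= t -> `|F s - F 0| <= c * s].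
have E0 : E 0.
  split=> [|s /andP[s0 s1]]; first by rewrite lexx ler01.
  have -> : s = 0 by apply/le_anti; rewrite s0 s1.
  by rewrite subrr normr0 mulr0.
have Eub : ubound E 1 by move=> t [/andP[]].
have supE : has_sup E by split; [exists 0|exists 1].
pose s0 := sup E.
have s00 : 0 <= s0 by exact: (sup_upper_bound supE E0).
have s01 : s0 <= 1 by apply: ge_sup => //; exists 0.
have /nbhs_ballP[r /= r0 hr] := Fl s0.
have hr' s : `|s - s0| < r -> `|F s - F s0| <= c * `|s - s0|.
  by move=> sr; apply: hr; rewrite -ball_normE /= distrC.
have Es0 : `|F s0 - F 0| <= c * s0.
  have [t Et ts0] := sup_adherent r0 supE.
  have tle : t <= s0 by exact: (sup_upper_bound supE Et).
  have [/andP[t0 _] ht] := Et.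
  have h1 := ht t; have h2 := hr' t.
  have -> : F s0 - F 0 = (F t - F 0) - (F t - F s0) by ring.
  rewrite (le_trans (ler_normB _ _))//.
  have -> : c * s0 = c * t + c * (s0 - t) by ring.
  apply: lerD; first by apply: ht; rewrite t0 lexx.
  have -> : s0 - t = `|t - s0| by rewrite distrC ger0_norm ?subr_ge0.
  apply: hr'.
  by rewrite distrC ger0_norm ?subr_ge0// ltrBlDl -ltrBlDr.
have all_le s : 0 <= s -> s < s0 + r -> `|F s - F 0| <= c * s.
  move=> s_ge0 ss; have [s_lt|s_ge] := ltP s s0.
    have [|t [_ ht] ts] := @sup_adherent _ E (s0 - s) _ supE.
      by rewrite subr_gt0.
    by apply: ht; rewrite s_ge0 /= ltW// (le_lt_trans _ ts)// opprB addrC subrK.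
  have -> : F s - F 0 = (F s - F s0) + (F s0 - F 0) by ring.
  rewrite (le_trans (ler_normD _ _))//.
  have -> : c * s = c * (s - s0) + c * s0 by ring.
  apply: lerD => //; have -> : s - s0 = `|s - s0| by rewrite ger0_norm ?subr_ge0.
  apply: hr'.
  by rewrite ger0_norm ?subr_ge0// ltrBlDl.
have [s1|s1] := leP 1 s0.
  by rewrite -[leRHS]mulr1; apply: all_le => //; rewrite (le_lt_trans s1)// ltrDl.
pose t := Num.min 1 (s0 + r / 2).
have ts0 : s0 < t by rewrite lt_min s1 ltrDl divr_gt0.
have Et : E t.
  split; first by rewrite (le_trans s00 (ltW ts0)) ge_min lexx.
  move=> s /andP[s_ge0]; rewrite le_min => /andP[_ sr]; apply: all_le => //.
  by apply: le_lt_trans sr _; rewrite ltrD2l ltr_pdivrMr// mulr2n mulrDr mulr1 ltrDl.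
by have := sup_upper_bound supE Et; rewrite leNgt ts0.
Qed.

(** Only differences with the centre [x] are controlled locally, which suits functions glued from
    affine pieces. The case [L = 0] says that a locally constant function is constant. *)
Lemma pointwise_lipschitz (V : normedModType R) (f : V -> R) (L : R) : 0 <= L ->
  (forall x, \forall y \near x, `|f y - f x| <= L * `|y - x|) ->
  forall x y, `|f y - f x| <= L * `|y - x|.
Proof.
move=> L0 fl x y; pose F t := f (x + t *: (y - x)).
have := @pointwise_lipschitz_segment F (L * `|y - x|).
have e1 : x + (y - x) = y by rewrite addrC subrK.
rewrite /F scale1r scale0r addr0 e1; apply => [|t]; first exact: mulr_ge0.
have cl : {for t, continuous (fun s : R => x + s *: (y - x))}.
  apply: continuousD; first exact: cst_continuous.
  by apply: continuousZr_tmp; exact: cvg_id.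
have : \forall s \near t, `|f (x + s *: (y - x)) - f (x + t *: (y - x))| <=
    L * `|x + s *: (y - x) - (x + t *: (y - x))| by exact: (cl _ (fl _)).
apply: filterS => s h.
apply: le_trans h _.
have -> : x + s *: (y - x) - (x + t *: (y - x)) = (s - t) *: (y - x).
  by rewrite opprD addrACA subrr add0r scalerBl.
by rewrite normrZ mulrCA mulrC.
Qed.

End pointwise_lipschitz.

Section truncated_square.
Context {R : realType}.
Implicit Types k a b : R.

Definition truncated_square k a : R := Num.max (a - k) 0 ^+ 2.

Lemma truncated_square_taylor k a b :
  `|truncated_square k b - truncated_square k a - 2 * Num.max (a - k) 0 * (b - a)| <=
  (b - a) ^+ 2.
Proof.
rewrite /truncated_square (_ : b - a = (b - k) - (a - k)); last by ring.
move: (a - k) (b - k) => u v; rewrite ler_norml.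
have := sqr_ge0 u; have := sqr_ge0 v; have := sqr_ge0 (v - u).
case: (lerP u 0) => hu; case: (lerP v 0) => hv h1 h2 h3;
  have := @mulr_ge0 _ `|u| `|v| (normr_ge0 _) (normr_ge0 _);
  rewrite ?(ler0_norm hu) ?(gtr0_norm hu) ?(ler0_norm hv) ?(gtr0_norm hv) => h4;
  apply/andP; split; nra.
Qed.

Lemma truncated_square_lipschitz k a b : 0 <= k -> a <= 1 -> b <= 1 ->
  `|truncated_square k b - truncated_square k a| <= 2 * `|b - a|.
Proof.
move=> k0 a1 b1; rewrite /truncated_square.
rewrite subr_sqr normrM mulrC; apply: ler_pM => //.
  rewrite ger0_norm; last by rewrite addr_ge0// le_max lexx orbT.
  by case: (lerP (a - k) 0) => ha; case: (lerP (b - k) 0) => hb; lra.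
have h1 := ler_norm (b - a); have := ler_norm (- (b - a)); rewrite normrN => h2.
rewrite ler_norml; case: (lerP (a - k) 0) => ha; case: (lerP (b - k) 0) => hb;
  apply/andP; split; lra.
Qed.

End truncated_square.

(** * Triangulations and finite element functions *)

Lemma compact_max (T : topologicalType) (R : realType) (f : T -> R) (A : set T) :
  A !=set0 -> compact A -> {within A, continuous f} ->
  exists2 c, A c & forall t, A t -> f t <= f c.
Proof.
move=> A0 cA cf; have [c /set_mem Ac h] := compact_EVT_max A0 cA cf.
by exists c => // t At; apply: h; exact/mem_set.
Qed.

Section bounded_sets.
Context {R : realType} {d : nat}.
Variables (D : set 'rV[R]_d) (A : R).
Hypothesis mD : measurable D.
Hypothesis bD : forall x, D x -> `|x| <= A.

Lemma bounded_rV_fin : (lebesgue_rV d D < +oo)%E.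
Proof.
by apply: (@lebesgue_rV_bounded _ _ _ (A + 1)) => // x /bD xA; rewrite ltr_pwDr.
Qed.

Lemma continuous_ess_bounded (f : 'rV[R]_d -> R) : continuous f ->
  ess_bounded (lebesgue_rV d) D f.
Proof.
move=> cf; pose K : set 'rV[R]_d := [set x | `|x| <= A].
have cK : compact K.
  apply: bounded_closed_compact.
    exists A; split; first exact: num_real.
    by move=> M AM x /= xA; rewrite (le_trans xA)// ltW.
  apply: (@closed_comp _ _ (fun x : 'rV[R]_d => `|x|) [set r | r <= A]) => //.
    by move=> x _; exact: norm_continuous.
have [M [_ hM]] := compact_bounded (continuous_compact (continuous_subspaceT cf) cK).
exists (f \_ D); last by apply: aeW => x Dx; rewrite patchE mem_set.
split.
  apply/(measurable_restrictT _ _).1 => //; apply: measurable_funTS.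
  apply: (measurability _ (RGenOpens.measurableE R)).
  move=> _ [_ [a [b ->] <-]]; rewrite setTI; apply: measurable_rV_open.
  by move: cf => /continuousP; apply; exact: interval_open.
exists (`|M| + 1) => x; rewrite patchE; case: ifPn => [/set_mem Dx|_]; last first.
  by rewrite normr0 addr_ge0.
apply: hM; first by rewrite ltr_pwDr// ler_norm.
by exists x => //; exact: bD.
Qed.

End bounded_sets.

Lemma dotv_affine_continuous (R : realType) d (q : 'rV[R]_d) (r : R) :
  continuous (fun y => dotv q y + r).
Proof.
by move=> y; apply: continuousD; [exact: dotv_continuous|exact: cst_continuous].
Qed.

Lemma is_derive_dotv (R : realType) d (q : 'rV[R]_d) (r : R) (x v : 'rV[R]_d) :
  is_derive x v (fun y => dotv q y + r) (dotv q v).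
Proof.
apply: is_derive_cvg; apply: cvg_near_cst; near=> h.
have h0 : h != 0 by near: h; exact: nbhs_dnbhs_neq.
rewrite dotvDr dotvZr [RHS](_ : _ = h^-1 *: (h * dotv q v)); last first.
  by rewrite /GRing.scale /= mulKf.
by congr (_ *: _); ring.
Unshelve. all: by end_near. Qed.

Section triangulation_geometry.
Context {R : realType} {d N : nat}.
Variables (Omega : set 'rV[R]_d) (p : 'I_N -> 'rV[R]_d) (Th : {set {set 'I_N}}).
Variable phi : 'I_N -> 'rV[R]_d -> R.
Variables (gr : {set 'I_N} -> 'I_N -> 'rV[R]_d) (cs : {set 'I_N} -> 'I_N -> R).
Local Notation lam T i y := (dotv (gr T i) y + cs T i).

(** [lam T i] extends [phi i] affinely from the cell [T] to the whole space: a barycentric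
    coordinate of [T] if [i \in T], and zero otherwise. *)
Definition affine_pieces := forall T i y, T \in Th -> hull p T y ->
  phi i y = lam T i y.

Hypothesis hTh : triangulation Omega p Th.
Hypothesis hphi : nodal_basis Omega p Th phi.
Hypothesis hgr : affine_pieces.
Hypothesis oO : open Omega.
Hypothesis regO : (closure Omega)° `<=` Omega.

Lemma cellsP (F : {set {set 'I_N}}) y :
  cells p F y <-> exists2 T, T \in F & hull p T y.
Proof. by split=> [[T]|[T]]; exists T. Qed.

Lemma closureP y : closure Omega y <-> exists2 T, T \in Th & hull p T y.
Proof. by case: hTh => _ _ <- _; exact: cellsP. Qed.

Lemma lam_vertexE T i j : T \in Th -> j \in T -> lam T i (p j) = (i == j)%:R.
Proof.
move=> TT jT; rewrite -hgr//; last exact: hull_vertex.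
by have [_ ->] := hphi i.
Qed.

Lemma card_cell T : T \in Th -> #|T| = d.+1.
Proof. by case: hTh => _ h _ _ /h[]. Qed.

Lemma cellP T y : T \in Th -> hull p T y <-> forall i, i \in T -> 0 <= lam T i y.
Proof.
move=> TT; apply: hullP; last exact: card_cell.
by move=> i j; exact: lam_vertexE.
Qed.

Lemma lam_sum T y : T \in Th -> \sum_(i in T) lam T i y = 1.
Proof.
move=> TT; apply: (@barycentric R d _ p (gr T) (cs T) T _ (card_cell TT) y).1.
by move=> i j; exact: lam_vertexE.
Qed.

Lemma lam_eq0 T i y : T \in Th -> i \notin T -> lam T i y = 0.
Proof.
move=> TT; apply: lam_notin; last exact: card_cell.
by move=> k j; exact: lam_vertexE.
Qed.

Lemma phi_notin T i y : T \in Th -> hull p T y -> i \notin T -> phi i y = 0.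
Proof. by move=> TT Ty iT; rewrite (hgr _ TT)// lam_eq0. Qed.

Lemma phi_gt0_mem T i y : T \in Th -> hull p T y -> 0 < phi i y -> i \in T.
Proof.
by move=> TT Ty; apply: contraTT => /(phi_notin TT Ty) ->; rewrite ltxx.
Qed.

Lemma phi_ge0 i y : closure Omega y -> 0 <= phi i y.
Proof.
move=> /closureP[T TT Ty]; have [iT|iT] := boolP (i \in T).
  by rewrite (hgr _ TT)//; move/cellP : Ty; apply.
by rewrite (phi_notin TT).
Qed.

Lemma phi_sum1 y : closure Omega y -> \sum_i phi i y = 1.
Proof.
move=> /closureP[T TT Ty]; rewrite -(lam_sum y TT) [RHS]big_mkcond.
by apply: eq_bigr => i _; case: ifPn => [_|/(phi_notin TT Ty)//]; rewrite (hgr _ TT).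
Qed.

Definition cell_int (T : {set 'I_N}) : set 'rV[R]_d := [set y | forall i, i \in T -> 0 < lam T i y].

Lemma lam_gt0_near T i y : 0 < lam T i y -> \forall z \near y, 0 < lam T i z.
Proof. by move=> h; apply: (cvgr_gt _ (@dotv_affine_continuous R d _ _ y)). Qed.

Lemma open_cell_int T : open (cell_int T).
Proof.
rewrite openE => y hy.
have : \forall z \near y, forall i, i \in T -> 0 < lam T i z; last by [].
apply: (@filter_forall 'rV[R]_d 'I_N (fun i z => i \in T -> 0 < lam T i z) (nbhs y) _) => i.
by apply: filter_imply => iT; exact/lam_gt0_near/hy.
Qed.

Lemma cell_int_hull T : T \in Th -> cell_int T `<=` hull p T.
Proof. by move=> TT y hy; apply/cellP => // i /hy/ltW. Qed.

Lemma cell_int_sub T : T \in Th -> cell_int T `<=` Omega.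
Proof.
move=> TT y hy; apply: regO; rewrite /interior.
have : \forall z \near y, cell_int T z.
  by apply: open_nbhs_nbhs; split => //; exact: open_cell_int.
by apply: filterS => z /(cell_int_hull TT) zT; apply/closureP; exists T.
Qed.

Lemma cell_int_neq0 T : T \in Th -> exists y, cell_int T y.
Proof.
move=> TT; exists (\sum_(i in T) (d.+1%:R^-1 : R) *: p i) => i iT.
have V i' j : j \in T -> lam T i' (p j) = (i' == j)%:R by exact: lam_vertexE.
rewrite (@affine_comb R d _ p (gr T) (cs T) T (fun=> d.+1%:R^-1)).
  rewrite (bigD1 i)//= V// eqxx mulr1 big1 ?addr0 ?invr_gt0//.
  by move=> j /andP[jT /negbTE ji]; rewrite V// eq_sym ji mulr0.
by rewrite sumr_const card_cell// -[LHS]mulr_natl divff.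
Qed.

(** At [y] every [phi i] with [i \in T] is positive, which forces [i \in S]; the two index sets have
    the same cardinality. *)
Lemma cell_int_unique S T y : S \in Th -> T \in Th -> cell_int T y -> hull p S y -> S = T.
Proof.
move=> SS TT Ty Sy; apply/esym/eqP; rewrite eqEcard !card_cell// leqnn andbT.
apply/fintype.subsetP => i iT; apply: (phi_gt0_mem SS Sy).
by rewrite (hgr _ TT) ?Ty//; exact: cell_int_hull.
Qed.

(** The exceptional points lie on finitely many sets [lam T i = 0] with [i \in T]. These are null
    because [lam T i] equals 1 at [p i] and so is not the zero function. *)
Lemma cell_int_ae :
  {ae lebesgue_rV d, forall x, Omega x -> exists2 T, T \in Th & cell_int T x}.
Proof.
have hyp (Ti : {set 'I_N} * 'I_N) : {ae lebesgue_rV d, forall x,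
    Ti.1 \in Th -> Ti.2 \in Ti.1 -> lam Ti.1 Ti.2 x != 0}.
  case: Ti => T i /=; have [TT|] := boolP (T \in Th); last by move=> _; exact: aeW.
  have [iT|] := boolP (i \in T); last by move=> _; exact: aeW.
  exists [set x | lam T i x = 0]; split.
  - have -> : [set y | lam T i y = 0] = setT `&` (fun y => lam T i y) @^-1` [set 0].
      by rewrite setTI.
    exact: measurable_dotv.
  - apply: lebesgue_rV_hyperplane; rewrite -negb_and; apply/negP => /andP[/eqP g0 /eqP c0].
    have := lam_vertexE i TT iT; rewrite g0 c0 dotv0l addr0 eqxx => /esym/eqP.
    by rewrite oner_eq0.
  - by move=> x /= h; apply: contrapT => /eqP nz; apply: h.
have : {ae lebesgue_rV d, forall x, forall Ti : {set 'I_N} * 'I_N,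
    Ti.1 \in Th -> Ti.2 \in Ti.1 -> lam Ti.1 Ti.2 x != 0}.
  exact: (@filter_forall _ _ (fun (Ti : {set 'I_N} * 'I_N) x =>
    Ti.1 \in Th -> Ti.2 \in Ti.1 -> lam Ti.1 Ti.2 x != 0)).
apply: filterS => x hx Ox; have /closureP[T TT Tx] := subset_closure Ox.
exists T => // i iT; rewrite lt_neqAle eq_sym (hx (T, i))//=.
by move/cellP : Tx; apply.
Qed.

Lemma partial_phi T i k x : T \in Th -> cell_int T x ->
  partial k (phi i) x = gr T i ord0 k.
Proof.
move=> TT Tx; have dl := is_derive_dotv (gr T i) (cs T i) x (delta_mx ord0 k).
have [|_] := @near_eq_is_derive _ _ _ _ (phi i) _ _ _ _ dl.
  have : \forall z \near x, cell_int T z.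
    by apply: open_nbhs_nbhs; split => //; exact: open_cell_int.
  by apply: filterS => z /(cell_int_hull TT) zT; rewrite (hgr _ TT).
by rewrite /partial => ->; exact: dotv_delta.
Qed.

Lemma lam_vertex_line T i j t y : T \in Th -> j \in T ->
  lam T i (p j + t *: (y - p j)) = (1 - t) * (i == j)%:R + t * lam T i y.
Proof.
by move=> TT; apply: lam_line => k l; exact: lam_vertexE.
Qed.

Lemma near_line (a v : 'rV[R]_d) (P : set 'rV[R]_d) : nbhs a P ->
  \forall t \near (0 : R)^'+, P (a + t *: v).
Proof.
move=> aP.
have cl : {for (0 : R), continuous (fun s : R => a + s *: v)}.
  apply: continuousD; first exact: cst_continuous.
  by apply: continuousZr_tmp; exact: cvg_id.
have : \forall s \near (0 : R), P (a + s *: v) by apply: cl; rewrite scale0r addr0.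
by rewrite near_withinE; apply: filterS => s ? _.
Qed.

Lemma phi_vertex_near i : Omega (p i) ->
  \forall z \near p i, Omega z /\ 0 < phi i z.
Proof.
move=> Oi; have nO : \forall z \near p i, Omega z by exact: open_nbhs_nbhs.
have [[cphi _] phiV] := hphi i.
have cO : {in Omega, continuous (phi i)}.
  have cw : {within Omega, continuous (phi i)}.
    exact: continuous_subspaceW (@subset_closure _ Omega) cphi.
  by rewrite continuous_open_subspace in cw.
near=> z; split; first by near: z.
near: z; apply: (cvgr_gt _ (cO (p i) _)); first exact/mem_set.
by rewrite phiV eqxx.
Unshelve. all: by end_near. Qed.

(* Homotheties centered at [p i] show that the cones at [p i] spanned by the cells
   around [p i] cover the space; near [x] only those containing [x] matter, and on
   these the barycentric coordinate of [p i] is positive near [x]. *)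
Lemma phi_support_interior i x : Omega (p i) -> closure Omega x -> 0 < phi i x ->
  Omega x.
Proof.
move=> Oi clx phix; apply: regO.
pose cone (S : {set 'I_N}) y := forall j, j \in S -> j != i -> 0 <= lam S j y.
have coneE y : exists S, [/\ S \in Th, i \in S & cone S y].
  have := near_line (y - p i) (phi_vertex_near Oi) => h.
  near (0 : R)^'+ => t; have t0 : 0 < t by [].
  have [Oz phiz] : Omega (p i + t *: (y - p i)) /\ 0 < phi i (p i + t *: (y - p i)).
    by near: t.
  have /closureP[S SS Sz] := subset_closure Oz.
  have iS := phi_gt0_mem SS Sz phiz.
  exists S; split => // j jS ji.
  move/cellP : Sz => /(_ SS j jS); rewrite lam_vertex_line// (negbTE ji) mulr0 add0r.
  by rewrite pmulr_rge0.
have /closureP[T TT Tx] := clx.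
have iT := phi_gt0_mem TT Tx phix.
(* Near [p i] the segment towards [x] lies in both [S] and [T], where both affine functions equal
   [phi i]; hence they agree along the whole line. *)
have cone_gt0 S : S \in Th -> i \in S -> cone S x -> 0 < lam S i x.
  move=> SS iS Sx; rewrite (hgr i TT Tx) in phix.
  suff -> : lam S i x = lam T i x by [].
  have h := near_line (x - p i) (lam_gt0_near (_ : 0 < lam S i (p i))).
  near (0 : R)^'+ => t; have t0 : 0 < t by [].
  have t1 : t < 1 by near: t; exact: nbhs_right_lt.
  pose z := p i + t *: (x - p i).
  have Sz : hull p S z.
    apply/cellP => // j jS; have [->|ji] := eqVneq j i.
      apply/ltW; rewrite /z; near: t; apply: h.
      by rewrite lam_vertexE// eqxx.
    rewrite /z lam_vertex_line// (negbTE ji) mulr0 add0r.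
    by apply: mulr_ge0; [exact: ltW|exact: Sx].
  have Tz : hull p T z.
    apply/cellP => // j jT; rewrite /z lam_vertex_line//; apply: addr_ge0.
      by apply: mulr_ge0 => //; rewrite subr_ge0 ltW.
    by apply: mulr_ge0; [exact: ltW|move/cellP : Tx; apply].
  have := hgr i SS Sz; rewrite (hgr i TT Tz) /z !lam_vertex_line// => /addrI.
  by move=> /(mulfI (lt0r_neq0 t0)).
rewrite /interior.
have : \forall y \near x, forall S : {set 'I_N}, S \in Th -> i \in S ->
    (cone S y -> 0 < lam S i y).
  apply: (@filter_forall 'rV[R]_d {set 'I_N} (fun S y => S \in Th -> i \in S ->
    (cone S y -> 0 < lam S i y)) (nbhs x) _) => S.
  apply: filter_imply => SS; apply: filter_imply => iS.
  have [Sx|nSx] := pselect (cone S x).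
    by apply: filterS (lam_gt0_near (cone_gt0 S SS iS Sx)) => y.
  have [j [jS ji jx]] : exists j, [/\ j \in S, j != i & lam S j x < 0].
    apply: contrapT => nj; apply: nSx => j jS ji; rewrite leNgt; apply/negP => jx.
    by apply: nj; exists j.
  have : \forall y \near x, lam S j y < 0.
    exact: (cvgr_lt _ (@dotv_affine_continuous R d _ _ x)).
  by apply: filterS => y jy /(_ j jS ji); rewrite leNgt jy.
apply: filterS => y hy; have [S [SS iS Sy]] := coneE y.
apply/closureP; exists S => //; apply/cellP => // j jS.
by have [->|ji] := eqVneq j i; [exact/ltW/hy|exact: Sy].
Unshelve. all: by end_near. Qed.

(** Interior points of [T] close to [p i] belong to the union, and a cell of [Gh] that contains one
    of them must be [T]. *)
Lemma interior_vertex_cells (Gh : {set {set 'I_N}}) i T : Gh \subset Th ->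
  (cells p Gh)° (p i) -> T \in Th -> i \in T -> T \in Gh.
Proof.
move=> GT Gi TT iT; have [b Tb] := cell_int_neq0 TT.
have h := near_line (b - p i) Gi.
near (0 : R)^'+ => t; have t0 : 0 < t by [].
have t1 : t < 1 by near: t; exact: nbhs_right_lt.
have /cellsP[S SG Sz] : cells p Gh (p i + t *: (b - p i)) by near: t.
rewrite -(@cell_int_unique S T (p i + t *: (b - p i)))//; first exact: (fintype.subsetP GT).
move=> j jT; rewrite lam_vertex_line//.
by rewrite ltr_wpDl ?mulr_gt0 ?Tb// mulr_ge0// subr_ge0 ltW.
Unshelve. all: by end_near. Qed.

Variable A : R.
Hypothesis hA : forall x, closure Omega x -> `|x| <= A.
Local Notation mu := (lebesgue_rV d).
Local Notation ebd := (ess_bounded mu Omega).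

Let mO : measurable Omega := measurable_rV_open oO.
Let hAO x : Omega x -> `|x| <= A.
Proof. by move=> /subset_closure/hA. Qed.
Let finO : (mu Omega < +oo)%E := bounded_rV_fin mO hAO.

Lemma measurable_cell_int T : measurable (cell_int T).
Proof. by apply: measurable_rV_open; exact: open_cell_int. Qed.

Lemma ess_bounded_cellwise (f : 'rV[R]_d -> R) (F : {set 'I_N} -> 'rV[R]_d -> R) :
  (forall T x, T \in Th -> cell_int T x -> f x = F T x) ->
  (forall T, T \in Th -> ebd (F T)) -> ebd f.
Proof.
move=> fF bF.
apply: (@ess_bounded_ae _ _ _ _ _ (fun x => \sum_(T in Th) (\1_(cell_int T) x * F T x))).
  apply: filterS cell_int_ae => x hx Ox; have [T TT Tx] := hx Ox.
  rewrite (bigD1 T)//= big1 ?addr0 => [|S /andP[SS ST]].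
    by rewrite indicE mem_set// mul1r (fF T).
  rewrite indicE memNset ?mul0r// => Sx; move/eqP : ST; apply.
  by apply: (cell_int_unique SS TT Tx); exact: cell_int_hull.
apply: (@ess_bounded_sum _ _ _ mu Omega _ _ (mem Th)
  (fun T x => \1_(cell_int T) x * F T x)) => T TT.
apply: ess_boundedM; last exact: bF.
exists (\1_(cell_int T) : 'rV[R]_d -> R); last exact: aeW.
split; first by apply: measurable_indic; exact: measurable_cell_int.
exists 1 => x; rewrite indicE; by case: (_ \in _); rewrite ?normr1 ?normr0 ?ler01 ?lexx.
Qed.

Lemma phi_ess_bounded i : ebd (phi i).
Proof.
apply: (@ess_bounded_cellwise _ (fun T x => lam T i x)) => T.
  by move=> x TT /(cell_int_hull TT); exact: hgr.
by move=> _; apply: (continuous_ess_bounded mO hAO); exact: dotv_affine_continuous.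
Qed.

Lemma partial_phi_ess_bounded i k : ebd (partial k (phi i)).
Proof.
apply: (@ess_bounded_cellwise _ (fun T x => gr T i ord0 k)) => T.
  by move=> x; exact: partial_phi.
by move=> _; exact: ess_bounded_cst.
Qed.

Lemma const_not_closure : (0 < d)%N -> ~ closure Omega (const_mx (`|A| + 1)).
Proof.
move=> d0 /hA; apply/negP; rewrite -ltNge.
apply: (@lt_le_trans _ _ (`|A| + 1)); first by rewrite ltr_pwDr// ler_norm.
have := coord_le_norm (const_mx (`|A| + 1) : 'rV[R]_d) (Ordinal d0); rewrite mxE.
exact/le_trans/ler_norm.
Qed.

(** * The sum of the hat functions over a set of interior vertices *)

Section interior_vertices.
Variable J : {set 'I_N}.
Hypothesis hJ : forall i, i \in J -> Omega (p i).

Definition hat x := \sum_(i in J) phi i x.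
Definition hat_grad T := \sum_(i in J) gr T i.
(** Elements of [P1_space] are arbitrary outside of the closure of [Omega], but the sampling grid
    leaves it; hence the extension by zero. *)
Definition hat0 := hat \_ (closure Omega).

Lemma hat_diff T x y : T \in Th -> hull p T x -> hull p T y ->
  hat y - hat x = dotv (hat_grad T) (y - x).
Proof.
move=> TT Tx Ty; rewrite /hat /hat_grad dotv_suml -sumrB; apply: eq_bigr => i _.
rewrite (hgr i TT Tx) (hgr i TT Ty) (_ : y - x = y + (-1) *: x) ?scaleN1r//.
by rewrite -scaleN1r dotvDr dotvZr; ring.
Qed.

Lemma hat0E x : closure Omega x -> hat0 x = hat x.
Proof. by move=> Ox; rewrite /hat0 patchE mem_set. Qed.

Lemma hat0_out x : ~ closure Omega x -> hat0 x = 0.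
Proof. by move=> Ox; rewrite /hat0 patchE memNset. Qed.

Lemma hat0_bounds x : 0 <= hat0 x <= 1.
Proof.
have [Ox|/hat0_out ->] := pselect (closure Omega x); last by rewrite lexx ler01.
rewrite hat0E// /hat sumr_ge0/=; last by move=> i _; exact: phi_ge0.
rewrite -(phi_sum1 Ox) [leRHS](bigID (mem J))/= lerDl sumr_ge0// => i _.
exact: phi_ge0.
Qed.

Lemma hat0_gt0 x : 0 < hat0 x -> Omega x.
Proof.
have [Ox|/hat0_out ->] := pselect (closure Omega x); last by rewrite ltxx.
rewrite hat0E// => h.
have [i iJ phix] : exists2 i, i \in J & 0 < phi i x.
  apply: contrapT => ni; move: h; rewrite /hat big1 ?ltxx// => i iJ.
  apply/eqP; rewrite eq_le phi_ge0// andbT leNgt; apply/negP => phix.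
  by apply: ni; exists i.
exact: (phi_support_interior (hJ iJ) Ox phix).
Qed.

(** It suffices to take y near x, and a cell containing such a y also contains x, so a single affine
    piece is compared with itself. If y is outside of the closure, then x is not in [Omega] and both
    values are 0. *)
Lemma hat0_lipschitz L : 0 <= L ->
  (forall T, T \in Th -> \sum_k `|hat_grad T ord0 k| <= L) ->
  forall x y, `|hat0 y - hat0 x| <= L * `|y - x|.
Proof.
move=> L0 hL; apply: pointwise_lipschitz => // x.
have [Ox|nOx] := pselect (closure Omega x); last first.
  have : \forall y \near x, (~` closure Omega) y.
    by apply: open_nbhs_nbhs; split => //; exact/closed_openC/closed_closure.
  apply: filterS => y nOy; rewrite !hat0_out// subrr normr0 mulr_ge0//.
have nearT : \forall y \near x, forall T, T \in Th -> hull p T y -> hull p T x.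
  apply: (@filter_forall 'rV[R]_d {set 'I_N} (fun T y => T \in Th -> hull p T y ->
    hull p T x) (nbhs x) _) => T; apply: filter_imply => TT.
  have [Tx|nTx] := pselect (hull p T x); first exact: nearW.
  have [j jT jx] : exists2 j, j \in T & lam T j x < 0.
    apply: contrapT => nj; apply: nTx; apply/cellP => // j jT.
    by rewrite leNgt; apply/negP => jx; apply: nj; exists j.
  have : \forall y \near x, lam T j y < 0.
    exact: (cvgr_lt _ (@dotv_affine_continuous R d _ _ x)).
  by apply: filterS => y jy /(cellP _ TT)/(_ j jT); rewrite leNgt jy.
have step y : (forall T, T \in Th -> hull p T y -> hull p T x) -> closure Omega y ->
    `|hat0 y - hat0 x| <= L * `|y - x|.
  move=> yx Oy; have /closureP[T TT Ty] := Oy.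
  rewrite !hat0E// (hat_diff TT (yx T TT Ty) Ty) (le_trans (dotv_le_norm _ _))//.
  by rewrite ler_wpM2r// hL.
have [Ox'|nOx] := pselect (Omega x).
  have nO : \forall y \near x, Omega y by exact: open_nbhs_nbhs.
  by apply: filterS2 nearT nO => y yx /subset_closure; exact: step.
apply: filterS nearT => y yx; have [Oy|nOy] := pselect (closure Omega y); first exact: step.
rewrite (hat0_out nOy) (_ : hat0 x = 0) ?subrr ?normr0 ?mulr_ge0//.
apply/eqP; rewrite eq_le; have /andP[-> _] := hat0_bounds x; rewrite andbT leNgt.
by apply/negP => /hat0_gt0.
Qed.

(** With zero gradients in all cells [hat0] would be constant, but it is 1 at [p i] and 0 at a point
    far away. *)
Lemma hat_grad_neq0 i : (0 < d)%N -> i \in J -> exists2 T, T \in Th & hat_grad T != 0.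
Proof.
move=> d0 iJ; apply: contrapT => nT.
have lip0 := @hat0_lipschitz 0 (lexx 0).
pose z : 'rV[R]_d := const_mx (`|A| + 1).
have nz : ~ closure Omega z := const_not_closure d0.
have : `|hat0 (p i) - hat0 z| <= 0 * `|p i - z|.
  apply: lip0 => T TT; rewrite big1// => k _.
  have [->|gT] := eqVneq (hat_grad T) 0; first by rewrite mxE normr0.
  by exfalso; apply: nT; exists T.
rewrite mul0r normr_le0 (hat0_out nz) subr0 hat0E; last exact/subset_closure/hJ.
rewrite /hat (bigD1 i)//= big1 ?addr0.
  by have [_ ->] := hphi i; rewrite eqxx oner_eq0.
by move=> j /andP[_ /negbTE ji]; have [_ ->] := hphi j; rewrite ji.
Qed.

(** * Vanishing of the convection term *)

Section convection.
Variable b : 'I_d -> 'rV[R]_d -> R.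
Hypothesis bb : forall k, ebd (b k).
Hypothesis divb : forall psi, test_function Omega psi ->
  \int[mu]_(x in Omega) (\sum_k b k x * partial k psi x) = 0.

(** Within [3 * del] of a point where [psi] is nonzero, [hat0] exceeds [kap], so at the point itself
    it is at least [kap / 2]. This superlevel set is closed, bounded and contained in [Omega]. *)
Lemma hat0_test_function L kap del psi : 0 < kap -> 0 <= L ->
  (forall x y, `|hat0 y - hat0 x| <= L * `|y - x|) -> L * (3 * del) <= kap / 2 ->
  smooth psi ->
  (forall x, psi x != 0 ->
    exists2 y, truncated_square kap (hat0 y) != 0 & `|x - y| <= 3 * del) ->
  test_function Omega psi.
Proof.
move=> kap0 L0 lip Ldel spsi psiW.
pose K := [set x | kap / 2 <= hat0 x].
have K_Omega : K `<=` Omega.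
  by move=> x /= xk; apply: hat0_gt0; apply: lt_le_trans xk; rewrite divr_gt0.
have clK : closed K.
  apply: (@closed_comp _ _ hat0 [set r | kap / 2 <= r]) => //.
  by move=> x _; apply: (norm_lipschitz_continuous (L := L)) => y z; exact: lip.
have suppK : closure [set x | psi x != 0] `<=` K.
  move: (clK) => /closure_id ->; apply: closureS => x /= /psiW[y Wy xy].
  have ky : kap < hat0 y.
    rewrite ltNge; apply/negP => yk; move/eqP: Wy; apply.
    by rewrite /truncated_square (max_idPr _) ?expr0n// subr_le0.
  have := lip x y; rewrite distrC => h.
  have := ler_norm (hat0 y - hat0 x); rewrite distrC => h2.
  have h3 : L * `|y - x| <= L * (3 * del) by rewrite ler_wpM2l// distrC.
  by rewrite /K /=; lra.
have cK : compact K.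
  apply: bounded_closed_compact => //; exists A; split; first exact: num_real.
  by move=> M AM x /K_Omega /hAO xA; apply: le_trans xA _; exact: ltW.
split => //; last exact: subset_trans K_Omega.
by apply: subclosed_compact cK suppK; exact: closed_closure.
Qed.

Lemma convection_hat :
  \int[mu]_(x in Omega)
    ((\sum_k b k x * \sum_(j in J) partial k (phi j) x) * hat x) = 0.
Proof.
pose L := \sum_(T in Th) \sum_k `|hat_grad T ord0 k|.
have L0 : 0 <= L by apply: sumr_ge0 => T _; exact: sumr_ge0.
have LT T : T \in Th -> \sum_k `|hat_grad T ord0 k| <= L.
  by move=> TT; rewrite /L (bigD1 T)//= lerDl sumr_ge0// => S _; exact: sumr_ge0.
have lip := hat0_lipschitz L0 LT.
pose kap n : R := n.+1%:R^-1; have kap0 n : 0 < kap n by rewrite invr_gt0.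
(* Chosen so that [L * (3 * del n) <= kap n / 2], as needed for the support; it also gives
   [3 * del n <= kap n]. *)
pose del n : R := kap n / (6 * (L + 1)).
have L1 : 0 < 6 * (L + 1) by rewrite mulr_gt0// ltr_wpDl.
have del0 n : 0 < del n by rewrite divr_gt0.
have delE n : kap n = del n * (6 * (L + 1)) by rewrite /del divfK// gt_eqF.
have /choice[psi psiP] : forall n, exists psi : 'rV[R]_d -> R,
  [/\ smooth psi,
      forall x, psi x != 0 ->
        exists2 y, truncated_square (kap n) (hat0 y) != 0 & `|x - y| <= 3 * del n &
      forall x q E k, `|x| <= A ->
        (forall y, `|y - x| <= 3 * del n ->
          `|truncated_square (kap n) (hat0 y) - truncated_square (kap n) (hat0 x)
            - dotv q (y - x)| <= E) ->
        `|partial k psi x - q ord0 k| <= 2 * E / del n].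
  move=> n; exact: (@quasi_interpolation R d A (del n)
    (fun x => truncated_square (kap n) (hat0 x)) (del0 n)).
have psi_test n : test_function Omega (psi n).
  have [s1 s2 _] := psiP n.
  apply: (hat0_test_function (kap0 n) L0 lip _ s1 s2).
  by rewrite delE; have := del0 n; nra.
have /choice[Kb hKb] : forall k, exists Kb, 0 <= Kb /\
    {ae mu, forall x, Omega x -> `|b k x| <= Kb}.
  move=> k; have [b' [_ [Kb hKb]] bE] := bb k; exists Kb.
  split; first exact: le_trans (hKb 0).
  by apply: filterS bE => x bE Ox; rewrite bE.
(* The slope q = 0 and the Lipschitz constant 2 L of the truncated square give E = 6 L del. *)
have dpsi_bound n k x : Omega x -> `|partial k (psi n) x| <= 12 * L.
  move=> Ox; have [_ _ h] := psiP n.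
  have := h x 0 (2 * (L * (3 * del n))) k (hAO Ox).
  rewrite mxE subr0 (_ : 2 * (2 * _) / _ = 12 * L); last first.
    by field; rewrite gt_eqF.
  apply => y yx; rewrite dotv0l subr0.
  have /andP[_ hx1] := hat0_bounds x; have /andP[_ hy1] := hat0_bounds y.
  rewrite (le_trans (truncated_square_lipschitz (ltW (kap0 n)) hx1 hy1))//.
  by rewrite ler_wpM2l// (le_trans (lip _ _))// ler_wpM2l.
(* Once the ball of radius [3 * del n] around [x] is inside the cell, [hat0] is affine there.
   Taylor's formula with slope 2 (w - kap)^+ grad w leaves E = 9 L^2 del^2. *)
have dpsi_cvg T k x : T \in Th -> cell_int T x ->
    partial k (psi n) x @[n --> \oo] --> 2 * hat x * hat_grad T ord0 k.
  move=> TT Tx; have Ox := cell_int_sub TT Tx.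
  have /nbhs_ballP[r /= r0 hr] : nbhs x (cell_int T).
    by apply: open_nbhs_nbhs; split => //; exact: open_cell_int.
  apply/cvgrPdist_le => e e0.
  (* Collects the interpolation error 18 L^2 del and the truncation error 2 kap |d_k w|, with
     [del n <= kap n]; the summand 1 keeps it positive. *)
  pose C := 18 * L ^+ 2 + 2 * `|hat_grad T ord0 k| + 1.
  have C0 : 0 < C by rewrite ltr_pwDr// addr_ge0// mulr_ge0// exprn_ge0.
  near=> n.
  have kr : kap n < r by near: n; exact: near_infty_natSinv_lt (PosNum r0).
  have ke : kap n < e / C.
    by near: n; exact: near_infty_natSinv_lt (PosNum (divr_gt0 e0 C0)).
  have [_ _ h] := psiP n.
  have d0 := del0 n; have dk : del n <= kap n by rewrite delE; nra.
  have {}h := h x ((2 * Num.max (hat0 x - kap n) 0) *: hat_grad T)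
    ((L * (3 * del n)) ^+ 2) k (hAO Ox).
  have {}h : `|partial k (psi n) x - 2 * Num.max (hat0 x - kap n) 0 *
      hat_grad T ord0 k| <= 18 * L ^+ 2 * del n.
    have := h; rewrite mxE (_ : 2 * _ / _ = 18 * L ^+ 2 * del n); last first.
      by field; rewrite gt_eqF.
    apply => y yx; rewrite dotvZl.
    have Ty : cell_int T y.
      apply: hr; rewrite -ball_normE /= distrC; apply: le_lt_trans yx _.
      by apply: le_lt_trans kr; rewrite delE; nra.
    rewrite -(hat_diff TT (cell_int_hull TT Tx) (cell_int_hull TT Ty)).
    rewrite -(hat0E (subset_closure Ox)) -(hat0E (subset_closure (cell_int_sub TT Ty))).
    have hh : `|hat0 y - hat0 x| <= L * (3 * del n).
      by apply: le_trans (lip _ _) _; rewrite ler_wpM2l.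
    have n0 := normr_ge0 (hat0 y - hat0 x).
    apply: le_trans (truncated_square_taylor _ _ _) _.
    rewrite -(ger0_norm (sqr_ge0 (hat0 y - hat0 x))) normrX.
    by apply: lerXn2r => //; rewrite ?nnegrE ?(le_trans n0 hh).
  rewrite -hat0E; last exact: subset_closure.
  have hk : `|Num.max (hat0 x - kap n) 0 - hat0 x| <= kap n.
    have /andP[hx0 _] := hat0_bounds x; have := kap0 n.
    by rewrite ler_norml; case: (lerP (hat0 x - kap n) 0) => ? ?; apply/andP; split; lra.
  have -> : 2 * hat0 x * hat_grad T ord0 k - partial k (psi n) x =
    - (partial k (psi n) x - 2 * Num.max (hat0 x - kap n) 0 * hat_grad T ord0 k) -
    2 * (Num.max (hat0 x - kap n) 0 - hat0 x) * hat_grad T ord0 k by ring.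
  apply: le_trans (ler_normB _ _) _; rewrite normrN.
  apply: (@le_trans _ _ (kap n * C)); last by rewrite -ler_pdivlMr// ltW.
  apply: (@le_trans _ _ (18 * L ^+ 2 * del n + 2 * kap n * `|hat_grad T ord0 k|)).
    apply: lerD => //; rewrite !normrM (ger0_norm (ler0n _ 2)).
    by rewrite ler_wpM2r// ler_wpM2l.
  have := normr_ge0 (hat_grad T ord0 k); have : 0 <= L ^+ 2 by rewrite exprn_ge0.
  have := kap0 n; rewrite /C; nra.
have bhat : ebd (fun x => (\sum_k b k x * \sum_(j in J) partial k (phi j) x) * hat x).
  apply: ess_boundedM; last first.
    by apply: ess_bounded_sum => i _; exact: phi_ess_bounded.
  apply: ess_bounded_sum => k _; apply: ess_boundedM => //.
  by apply: ess_bounded_sum => i _; exact: partial_phi_ess_bounded.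
have : \int[mu]_(x in Omega) (2 *
    ((\sum_k b k x * \sum_(j in J) partial k (phi j) x) * hat x)) = 0.
  apply: (@bounded_convergence0 _ _ _ mu Omega mO finO
    (fun n x => \sum_k b k x * partial k (psi n) x) _ (\sum_k Kb k * (12 * L))).
  - move=> n; apply: ess_bounded_sum => k _; apply: ess_boundedM => //.
    apply: (continuous_ess_bounded mO hAO).
    by have [/(_ [:: k])[]] := psi_test n.
  - by apply: ess_boundedM => //; exact: ess_bounded_cst.
  - move=> n.
    have : {ae mu, forall x, forall k, Omega x -> `|b k x| <= Kb k}.
      by apply: (@filter_forall _ _ (fun k x => Omega x -> `|b k x| <= Kb k)) => k;
        have [] := hKb k.
    apply: filterS => x hx Ox; apply: (le_trans (ler_norm_sum _ _ _)).
    by apply: ler_sum => k _; rewrite normrM ler_pM ?hx ?dpsi_bound.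
  - apply: filterS cell_int_ae => x hx Ox; have [T TT Tx] := hx Ox.
    have -> : 2 * ((\sum_k b k x * \sum_(j in J) partial k (phi j) x) * hat x) =
        \sum_k b k x * (2 * hat x * hat_grad T ord0 k).
      rewrite mulrCA mulr_suml; apply: eq_bigr => k _.
      have -> : \sum_(j in J) partial k (phi j) x = hat_grad T ord0 k; last by ring.
      by rewrite /hat_grad summxE; apply: eq_bigr => j _; exact: partial_phi.
    apply: cvg_big => [[y z]|k _]; first exact: add_continuous.
    apply: cvgM; first exact: cvg_cst.
    exact: dpsi_cvg.
  - by move=> n; exact: divb.
rewrite RintegralZl_ess// => /eqP; rewrite mulf_eq0 pnatr_eq0 /= => /eqP.
exact.
Unshelve. all: by end_near. Qed.

End convection.

End interior_vertices.

(** * Topology of unions of cells *)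

Section cells_topology.
Variable Gh : {set {set 'I_N}}.
Hypothesis hGh : Gh \subset Th.
Local Notation G := (cells p Gh).

Lemma cells_closed : closed G.
Proof.
rewrite -openC openE => y nGy.
have : \forall z \near y, forall T, T \in Gh -> ~ hull p T z.
  apply: (@filter_forall 'rV[R]_d {set 'I_N} (fun T z => T \in Gh -> ~ hull p T z)
    (nbhs y) _) => T; apply: filter_imply => TG.
  have TT : T \in Th := fintype.subsetP hGh _ TG.
  have [j jT jy] : exists2 j, j \in T & lam T j y < 0.
    apply: contrapT => nj; apply: nGy; apply/cellsP; exists T => //.
    apply/cellP => // j jT; rewrite leNgt; apply/negP => jy; apply: nj.
    by exists j.
  have : \forall z \near y, lam T j z < 0.
    exact: (cvgr_lt _ (@dotv_affine_continuous R d _ _ y)).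
  by apply: filterS => z jz /(cellP _ TT)/(_ j jT); rewrite leNgt jz.
by apply: filterS => z hz /cellsP[T TG Tz]; exact: hz TG Tz.
Qed.

Lemma cells_sub_closure : G `<=` closure Omega.
Proof.
by move=> x /cellsP[T TG Tx]; apply/closureP; exists T => //; exact: (fintype.subsetP hGh).
Qed.

Lemma cells_compact : compact G.
Proof.
apply: bounded_closed_compact cells_closed; exists A; split; first exact: num_real.
by move=> K AK x /cells_sub_closure/hA xA; apply: le_trans xA _; exact: ltW.
Qed.

(* Without boundary the indicator of the union would be locally constant. *)
Lemma cells_boundary_neq0 : (0 < d)%N -> Gh != finset.set0 -> boundary G !=set0.
Proof.
move=> d0 /finset.set0Pn[T TG]; have TT : T \in Th := fintype.subsetP hGh _ TG.
apply/set0P/negP => /eqP b0.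
have oG : open G.
  rewrite openE => x Gx; apply: contrapT => nGx.
  suff : boundary G x by rewrite b0.
  by split => //; exact: subset_closure.
pose f x : R := \1_G x.
have f_loc x : \forall y \near x, `|f y - f x| <= 0 * `|y - x|.
  have [Gx|nGx] := pselect (G x).
    have : \forall y \near x, G y by exact: open_nbhs_nbhs.
    apply: filterS => y Gy.
    by rewrite /f !indicE !mem_set// subrr normr0 mul0r.
  have : \forall y \near x, (~` G) y.
    by apply: open_nbhs_nbhs; split => //; exact/closed_openC/cells_closed.
  apply: filterS => y Gy.
  by rewrite /f !indicE !memNset// subrr normr0 mul0r.
have [y Ty] := cell_int_neq0 TT.
have Gy : G y by apply/cellsP; exists T => //; exact: cell_int_hull.
have nGz : ~ G (const_mx (`|A| + 1)).
  by move=> /cells_sub_closure; exact: const_not_closure.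
have := pointwise_lipschitz (lexx 0) f_loc y (const_mx (`|A| + 1)).
by rewrite mul0r /f !indicE (mem_set Gy) (memNset nGz) sub0r normrN normr1 ler10.
Qed.

End cells_topology.

(** * Integrals of finite element functions, computed cell by cell *)

Lemma ae_cell_int (P : 'rV[R]_d -> Prop) :
  (forall T x, T \in Th -> cell_int T x -> P x) -> {ae mu, forall x, Omega x -> P x}.
Proof.
by move=> h; apply: filterS cell_int_ae => x hx /hx[T TT Tx]; exact: h TT Tx.
Qed.

Lemma affine_sum_grad (T : {set 'I_N}) (a : R) (P : pred 'I_N) :
  (forall y, \sum_(i | P i) lam T i y = a) -> \sum_(i | P i) gr T i = 0.
Proof.
move=> h; apply/rowP => k; rewrite mxE.
have := h (delta_mx ord0 k); rewrite -(h 0) big_split [in RHS]big_split /= => /addIr.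
rewrite -!dotv_suml dotv0r => e; rewrite summxE -[RHS]e dotv_suml.
by apply: eq_bigr => i _; rewrite dotv_delta.
Qed.

Lemma gr_notin T i : T \in Th -> i \notin T -> gr T i = 0.
Proof.
move=> TT iT; have := @affine_sum_grad T 0 (pred1 i); rewrite big_pred1_eq; apply.
by move=> y; rewrite big_pred1_eq; exact: lam_eq0.
Qed.

Lemma gr_sum0 T : T \in Th -> \sum_i gr T i = 0.
Proof.
move=> TT; apply: (@affine_sum_grad T 1) => y; rewrite -(lam_sum y TT) [RHS]big_mkcond.
by apply: eq_bigr => i _; case: ifPn => // /(lam_eq0 y TT).
Qed.

Lemma not_neighbours i j T : j \notin neighbours Th i -> j != i -> T \in Th ->
  i \in T -> j \notin T.
Proof.
rewrite inE => + ji TT iT; rewrite ji /=; apply: contraNN => jT.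
by apply/existsP; exists T; rewrite TT iT.
Qed.

Lemma Rintegral_sumM (I : finType) (P : pred I) (F : I -> 'rV[R]_d -> R) h :
  (forall j, ebd (F j)) -> ebd h ->
  \sum_(j | P j) \int[mu]_(x in Omega) (F j x * h x) =
  \int[mu]_(x in Omega) ((\sum_(j | P j) F j x) * h x).
Proof.
move=> bF bh; rewrite -(Rintegral_sum_ess mO finO).
  by apply: eq_Rintegral => x _; rewrite mulr_suml.
by move=> j _; exact: ess_boundedM.
Qed.

Lemma Rintegral_sum_sumM (I : finType) (P Q : pred I) (F G : I -> 'rV[R]_d -> R) :
  (forall j, ebd (F j)) -> (forall j, ebd (G j)) ->
  \sum_(i | Q i) \sum_(j | P j) \int[mu]_(x in Omega) (F j x * G i x) =
  \int[mu]_(x in Omega) ((\sum_(j | P j) F j x) * (\sum_(i | Q i) G i x)).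
Proof.
move=> bF bG.
under eq_bigr do rewrite Rintegral_sumM//.
transitivity (\sum_(i | Q i) \int[mu]_(x in Omega) (G i x * \sum_(j | P j) F j x)).
  by apply: eq_bigr => i _; apply: eq_Rintegral => x _; rewrite mulrC.
rewrite Rintegral_sumM//; last by apply: ess_bounded_sum => j _; exact: bF.
by apply: eq_Rintegral => x _; rewrite mulrC.
Qed.

Lemma Rintegral_ae_eq0 (f : 'rV[R]_d -> R) :
  {ae mu, forall x, Omega x -> f x = 0} -> \int[mu]_(x in Omega) f x = 0.
Proof.
by move=> f0; rewrite (ae_eq_Rintegral f0) Rintegral_cst// mul0r.
Qed.

(** [f] dominates [s] times the indicator of [V], and a nonempty open set has positive measure. *)
Lemma Rintegral_gt0_open (f : 'rV[R]_d -> R) (V : set 'rV[R]_d) (s : R) :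
  ebd f -> (forall x, 0 <= f x) -> open V -> V !=set0 -> V `<=` Omega -> 0 < s ->
  (forall x, V x -> f x = s) -> 0 < \int[mu]_(x in Omega) f x.
Proof.
move=> bf f0 oV V0 VO s0 fs; have mV := measurable_rV_open oV.
have bV : ebd (fun x => \1_V x).
  exists (\1_V : 'rV[R]_d -> R); last exact: aeW.
  split; first exact: measurable_indic.
  by exists 1 => x; rewrite indicE; case: (_ \in _); rewrite ?normr1 ?normr0 ?ler01 ?lexx.
have iV : 0 < \int[mu]_(x in Omega) \1_V x.
  rewrite /Rintegral integral_indic// setIidl// fine_gt0//.
  rewrite lebesgue_rV_open_gt0//=.
  by apply: le_lt_trans finO; apply: le_measure; rewrite ?inE.
have : 0 <= \int[mu]_(x in Omega) (f x + (- s) * \1_V x).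
  apply: Rintegral_ge0 => x _; rewrite indicE; case: (boolP (x \in V)) => [/set_mem|_].
    by move=> /fs ->; rewrite mulr1 subrr.
  by rewrite mulr0 addr0.
rewrite (RintegralD_ess mO finO)//; last by apply: ess_boundedM => //; exact: ess_bounded_cst.
rewrite (RintegralZl_ess mO finO)// mulNr subr_ge0; apply: lt_le_trans.
exact: mulr_gt0.
Qed.

(** * Row sums and diagonal blocks of the bilinear form *)

Section forms.
Variables (b : 'rV[R]_d -> 'rV[R]_d) (c : 'rV[R]_d -> R) (eps : R).
Hypothesis bb : forall k, ebd (fun x => b x ord0 k).
Hypothesis bc : ebd c.
Hypothesis c0 : {ae mu, forall x, Omega x -> 0 <= c x}.
Hypothesis eps0 : 0 < eps.
Hypothesis divb : forall psi, test_function Omega psi ->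
  \int[mu]_(x in Omega) (\sum_k b x ord0 k * partial k psi x) = 0.

Let stiff j i := \int[mu]_(x in Omega)
  (\sum_(k < d) partial k (phi j) x * partial k (phi i) x).
Let conv j i := innerL2 Omega (fun x => \sum_(k < d) b x ord0 k * partial k (phi j) x) (phi i).
Let mass j i := innerL2 Omega (fun x => c x * phi j x) (phi i).
Let dcf j i := diffusion_convection Omega eps b (phi j) (phi i).

Let dcfE j i : dcf j i = eps * stiff j i + conv j i. Proof. by []. Qed.

Let stiffE j i : stiff j i =
  \sum_k \int[mu]_(x in Omega) (partial k (phi j) x * partial k (phi i) x).
Proof.
apply: (Rintegral_sum_ess mO finO) => k _.
by apply: ess_boundedM; exact: partial_phi_ess_bounded.
Qed.

Let conv_ebd j : ebd (fun x => \sum_(k < d) b x ord0 k * partial k (phi j) x).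
Proof.
by apply: ess_bounded_sum => k _; apply: ess_boundedM => //; exact: partial_phi_ess_bounded.
Qed.

Let mass_ebd j : ebd (fun x => c x * phi j x).
Proof. by apply: ess_boundedM => //; exact: phi_ess_bounded. Qed.

(** The hat functions sum to 1, whose gradient is zero. *)
Lemma diffusion_convection_row i : \sum_j diffusion_convection Omega eps b (phi j) (phi i) = 0.
Proof.
have sum0 T k x : T \in Th -> cell_int T x -> \sum_j partial k (phi j) x = 0.
  move=> TT Tx; have := congr1 (fun v : 'rV_d => v ord0 k) (gr_sum0 TT).
  rewrite summxE [RHS]mxE => e; rewrite -[RHS]e; apply: eq_bigr => j _.
  exact: partial_phi.
rewrite big_split /= -mulr_sumr [X in eps * X](_ : _ = 0) ?mulr0 ?add0r.
  rewrite /innerL2 Rintegral_sumM//; last exact: phi_ess_bounded.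
  apply: Rintegral_ae_eq0; apply: ae_cell_int => T x TT Tx.
  rewrite exchange_big big1 ?mul0r// => k _.
  by rewrite -mulr_sumr (sum0 T)// mulr0.
transitivity (\sum_j stiff j i) => //.
under eq_bigr do rewrite stiffE; rewrite exchange_big big1// => k _.
rewrite /= Rintegral_sumM => [|j|]; [|exact: partial_phi_ess_bounded..].
apply: Rintegral_ae_eq0; apply: ae_cell_int => T x TT Tx.
by rewrite (sum0 T)// mul0r.
Qed.

Lemma mass_row i : \sum_j mass j i = innerL2 Omega c (phi i).
Proof.
rewrite /mass /innerL2 Rintegral_sumM//; last exact: phi_ess_bounded.
apply: eq_Rintegral => x /set_mem/subset_closure/phi_sum1 h.
by rewrite -mulr_sumr h mulr1.
Qed.

Lemma partial_phi_notin T i k x : T \in Th -> cell_int T x -> i \notin T ->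
  partial k (phi i) x = 0.
Proof. by move=> TT Tx iT; rewrite (partial_phi _ _ TT Tx) gr_notin// mxE. Qed.

Lemma diffusion_convection_far i j : j \notin neighbours Th i -> j != i ->
  diffusion_convection Omega eps b (phi j) (phi i) = 0.
Proof.
move=> nij ji; rewrite -[LHS]/(eps * stiff j i + conv j i).
have -> : stiff j i = 0.
  apply: Rintegral_ae_eq0; apply: ae_cell_int => T x TT Tx; rewrite big1// => k _.
  have [iT|iT] := boolP (i \in T); last by rewrite (partial_phi_notin k TT Tx iT) mulr0.
  by rewrite (partial_phi_notin k TT Tx (not_neighbours nij ji TT iT)) mul0r.
rewrite mulr0 add0r; apply: Rintegral_ae_eq0; apply: ae_cell_int => T x TT Tx.
have [iT|iT] := boolP (i \in T); last first.
  by rewrite (phi_notin TT (cell_int_hull TT Tx) iT) mulr0.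
rewrite big1 ?mul0r// => k _.
by rewrite (partial_phi_notin k TT Tx (not_neighbours nij ji TT iT)) mulr0.
Qed.

Lemma mass_far i j : j \notin neighbours Th i -> j != i -> mass j i = 0.
Proof.
move=> nij ji; apply: Rintegral_ae_eq0; apply: ae_cell_int => T x TT Tx.
have Tx' := cell_int_hull TT Tx.
have [iT|iT] := boolP (i \in T); last by rewrite (phi_notin TT Tx' iT) mulr0.
by rewrite (phi_notin TT Tx' (not_neighbours nij ji TT iT)) mulr0 mul0r.
Qed.

Section interior_block.
Variable J : {set 'I_N}.
Hypothesis hJ : forall i, i \in J -> Omega (p i).

(** Without the convection part, the block is eps times the integral of |grad w|^2, and
    [hat_grad_neq0] supplies a cell with a nonzero constant gradient. *)
Lemma diffusion_convection_block i0 : (0 < d)%N -> i0 \in J ->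
  0 < \sum_(i in J) \sum_(j in J) diffusion_convection Omega eps b (phi j) (phi i).
Proof.
move=> d0 i0J.
have -> : \sum_(i in J) \sum_(j in J) diffusion_convection Omega eps b (phi j) (phi i) =
    eps * (\sum_(i in J) \sum_(j in J) stiff j i) + \sum_(i in J) \sum_(j in J) conv j i.
  rewrite mulr_sumr -big_split; apply: eq_bigr => i _.
  by rewrite mulr_sumr -big_split.
have -> : \sum_(i in J) \sum_(j in J) conv j i = 0.
  rewrite Rintegral_sum_sumM//; last exact: phi_ess_bounded.
  rewrite -[RHS](convection_hat hJ bb divb); apply: eq_Rintegral => x _; congr (_ * _).
  by rewrite exchange_big; apply: eq_bigr => k _; rewrite mulr_sumr.
rewrite addr0 mulr_gt0//.
pose f k x := \sum_(j in J) partial k (phi j) x.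
have bf k : ebd (f k).
  by apply: ess_bounded_sum => j _; exact: partial_phi_ess_bounded.
have -> : \sum_(i in J) \sum_(j in J) stiff j i =
    \sum_k \int[mu]_(x in Omega) (f k x * f k x).
  under eq_bigr do under eq_bigr do rewrite stiffE.
  under eq_bigr do rewrite exchange_big; rewrite exchange_big; apply: eq_bigr => k _.
  by rewrite /= Rintegral_sum_sumM => [|j|j]; [|exact: partial_phi_ess_bounded..].
have [T TT gT] := hat_grad_neq0 hJ d0 i0J.
have [k gk] : exists k, hat_grad J T ord0 k != 0.
  apply: contrapT => nk; move/eqP: gT; apply; apply/rowP => k; rewrite mxE.
  by apply/eqP; apply: contrapT => /negP gk; apply: nk; exists k.
rewrite (bigD1 k)//= ltr_pwDl//; last first.
  by apply: sumr_ge0 => l _; apply: Rintegral_ge0 => x _; rewrite -expr2 sqr_ge0.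
have [y Ty] := cell_int_neq0 TT.
apply: (@Rintegral_gt0_open _ (cell_int T) (hat_grad J T ord0 k ^+ 2)).
- exact: ess_boundedM.
- by move=> x; rewrite -expr2 sqr_ge0.
- exact: open_cell_int.
- by exists y.
- exact: cell_int_sub.
- by rewrite exprn_even_gt0.
- move=> x Tx; rewrite -expr2; congr (_ ^+ 2); rewrite /hat_grad summxE.
  by apply: eq_bigr => j _; exact: partial_phi.
Qed.

Lemma mass_block : 0 <= \sum_(i in J) \sum_(j in J) mass j i.
Proof.
rewrite Rintegral_sum_sumM//; last exact: phi_ess_bounded.
apply: Rintegral_ae_ge0; apply: filterS c0 => x h Ox.
by rewrite -mulr_sumr -mulrA mulr_ge0 ?h// -expr2 sqr_ge0.
Qed.

End interior_block.

Lemma reaction_ge0 i : 0 <= innerL2 Omega c (phi i).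
Proof.
apply: Rintegral_ae_ge0; apply: filterS c0 => x h Ox.
by rewrite mulr_ge0 ?h// phi_ge0//; exact: subset_closure.
Qed.

Variable M : nat.
Hypothesis hint : forall i : 'I_N, (i < M)%N -> Omega (p i).

Lemma lumpedE (i j : 'I_N) : (i < M)%N ->
  \sum_(l < N | (l < M)%N) innerL2 Omega c (phi l) * phi j (p l) * phi i (p l) =
  (j == i)%:R * innerL2 Omega c (phi i).
Proof.
have nod l m : phi l (p m) = (l == m)%:R by have [_] := hphi l; exact.
move=> iM; rewrite (bigD1 i)//= !nod eqxx mulr1 mulrC big1 ?addr0// => l /andP[_ li].
by rewrite (nod i l) eq_sym (negbTE li) mulr0.
Qed.

Variable ah : ('rV[R]_d -> R) -> ('rV[R]_d -> R) -> R.
Hypothesis hah : ah = form_a Omega eps b c \/ ah = form_a_lumped Omega eps b c M p phi.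

(** The row sum is the form with first argument 1. Only the reaction is left, and lumping preserves
    its row sums. *)
Lemma form_row (i : 'I_N) : (i < M)%N -> \sum_j ah (phi j) (phi i) = innerL2 Omega c (phi i).
Proof.
move=> iM; case: hah => ->; rewrite big_split /= diffusion_convection_row add0r.
  exact: mass_row.
under eq_bigr do rewrite lumpedE//.
by rewrite (bigD1 i)//= eqxx mul1r big1 ?addr0// => j /negbTE ->; rewrite mul0r.
Qed.

Lemma form_far (i j : 'I_N) : (i < M)%N -> j \notin neighbours Th i -> j != i ->
  ah (phi j) (phi i) = 0.
Proof.
move=> iM nij ji; case: hah => ->.
  by rewrite /form_a diffusion_convection_far// add0r; exact: mass_far.
by rewrite /form_a_lumped diffusion_convection_far// add0r lumpedE// (negbTE ji) mul0r.
Qed.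

Lemma form_block_gt0 (J : {set 'I_N}) i0 : (0 < d)%N ->
  (forall i, i \in J -> (i < M)%N) -> i0 \in J ->
  0 < \sum_(i in J) \sum_(j in J) ah (phi j) (phi i).
Proof.
move=> d0 JM i0J; have hJ i : i \in J -> Omega (p i) by move=> /JM/hint.
case: hah => ->.
  under eq_bigr do rewrite big_split /=; rewrite big_split /=.
  by rewrite ltr_pwDl ?(diffusion_convection_block hJ d0 i0J)//; exact: mass_block.
under eq_bigr do rewrite big_split /=; rewrite big_split /=.
rewrite ltr_pwDl ?(diffusion_convection_block hJ d0 i0J)//.
apply: sumr_ge0 => i iJ; apply: sumr_ge0 => j jJ; rewrite lumpedE ?JM//.
by rewrite mulr_ge0// reaction_ge0.
Qed.

(** * The maximum principle on a union of cells *)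

Section maximum.
Variable B : 'rV[R]_N -> 'M[R]_N.
Hypothesis hBneg : forall U i j, i != j -> B U i j <= 0.
Hypothesis hBsum : forall U i, \sum_(j < N) B U i j = 0.
Hypothesis hBsupp : forall U (i j : 'I_N), (i < M)%N ->
  j \notin neighbours Th i -> j != i -> B U i j = 0.
Hypothesis hA1 : forall i j : 'I_N, (i < M)%N ->
  continuous (fun U : 'rV[R]_N => B U i j * (U ord0 j - U ord0 i)).
(** This is the half of (A2) on maxima. The half on minima is the same statement for the matrices
    [B (- V)], through which the minimum principle is reached. *)
Hypothesis hA2 : forall (U : 'rV[R]_N) (i : 'I_N), (i < M)%N ->
  (forall j, j \in neighbours Th i -> U ord0 j < U ord0 i) ->
  forall j, j \in neighbours Th i -> ah (phi j) (phi i) + B U i j <= 0.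
Hypothesis hbnd : forall i : 'I_N, (M <= i)%N -> boundary Omega (p i).
Variable Gh : {set {set 'I_N}}.
Hypothesis hGh : Gh \subset Th.
Variables (U : 'rV[R]_N) (gam : 'I_N -> R).
Local Notation G := (cells p Gh).
Local Notation uh := (fun x => \sum_(i < N) U ord0 i * phi i x).
Local Notation at_ i j := (ah (phi j) (phi i) + B U i j).
Hypothesis hU : forall i : 'I_N, (i < M)%N -> \sum_(j < N) at_ i j * U ord0 j = gam i.

(* [U + alpha e_i] has a strict local maximum at [i] for every [alpha > 0]; (A2) then
   gives the sign of the row of [i], and (A1) survives the limit [alpha -> 0]. *)
Lemma local_max_row (i j : 'I_N) : (i < M)%N ->
  (forall l, l \in neighbours Th i -> U ord0 l <= U ord0 i) ->
  0 <= at_ i j * (U ord0 j - U ord0 i).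
Proof.
move=> iM Ule; have [->|ji] := eqVneq j i; first by rewrite subrr mulr0.
have [ij|nij] := boolP (j \in neighbours Th i); last first.
  by rewrite form_far// hBsupp// addr0 mul0r.
pose V (al : R) : 'rV[R]_N := U + al *: delta_mx ord0 i.
have Vi al : V al ord0 i = U ord0 i + al by rewrite !mxE !eqxx mulr1.
have Vl al l : l != i -> V al ord0 l = U ord0 l.
  by move=> /negbTE li; rewrite !mxE li andbF mulr0 addr0.
pose a := ah (phi j) (phi i).
(* (A1) gives continuity only of the product with u_j - u_i, so the limit is taken in the product.
   For [al > 0], [h al] is a product of two nonpositive factors. *)
pose h al := a * (U ord0 j - U ord0 i - al) + B (V al) i j * (V al ord0 j - V al ord0 i).
have V0 : V 0 = U by rewrite /V scale0r addr0.
have -> : at_ i j * (U ord0 j - U ord0 i) = h 0.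
  by rewrite /h V0 subr0 -mulrDl.
have ch : {for (0 : R), continuous h}.
  have cV : {for (0 : R), continuous V}.
    apply: continuousD; first exact: cst_continuous.
    by apply: continuousZr_tmp; exact: cvg_id.
  have cB : {for (0 : R), continuous (fun al => B (V al) i j * (V al ord0 j - V al ord0 i))}.
    have cF := @hA1 i j iM (V 0).
    exact: (@cvg_comp _ _ _ V (fun W : 'rV[R]_N => B W i j * (W ord0 j - W ord0 i)) _ _ _ cV cF).
  have c1 : {for (0 : R), continuous (fun al => a * (U ord0 j - U ord0 i - al))}.
    apply: continuousM; first exact: cst_continuous.
    by apply: continuousB; [exact: cst_continuous|exact: cvg_id].
  exact: continuousD c1 cB.
rewrite leNgt; apply/negP => h0.
have : \forall al \near (0 : R)^'+, h al < 0.
  have : \forall al \near (0 : R), h al < 0 by exact: (cvgr_lt _ ch _ h0).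
  rewrite near_withinE.
  by apply: filterS => al ? _.
move=> near_h; near (0 : R)^'+ => al; have al0 : 0 < al by [].
have : h al < 0 by near: al.
rewrite ltNge => /negP; apply.
have a2 : a + B (V al) i j <= 0.
  apply: hA2 => // l il; rewrite Vi Vl; first by rewrite (le_lt_trans (Ule l il))// ltrDl.
  by move: il; rewrite inE => /andP[].
rewrite /h Vi Vl// (_ : _ - (_ + _) = U ord0 j - U ord0 i - al); last by rewrite opprD addrA.
rewrite -mulrDl mulr_le0//.
by have := Ule j ij; move: al0; lra.
Unshelve. all: by end_near. Qed.

Lemma uh_vertex i : uh (p i) = U ord0 i.
Proof.
rewrite /= (bigD1 i)//=; have [_ ->] := hphi i; rewrite eqxx mulr1 big1 ?addr0//.
by move=> j /negbTE ji; have [_ ->] := hphi j; rewrite ji mulr0.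
Qed.

(** [uh x] is a convex combination of vertex values that do not exceed it, so every vertex with
    positive weight attains it. *)
Lemma uh_max_vertex x : G x -> (forall T i, T \in Gh -> i \in T -> U ord0 i <= uh x) ->
  exists i, (exists2 T, T \in Gh & i \in T) /\ U ord0 i = uh x.
Proof.
move=> /cellsP[T TG Tx] hs; have TT : T \in Th by exact: (fintype.subsetP hGh).
apply: contrapT => ni.
have : \sum_(i in T) lam T i x * (uh x - U ord0 i) = 0.
  under eq_bigr do rewrite mulrBr; rewrite sumrB -mulr_suml lam_sum// mul1r.
  apply/eqP; rewrite subr_eq0; apply/eqP; rewrite [RHS]big_mkcond; apply: eq_bigr => i _.
  case: ifPn => iT; first by rewrite (hgr i TT Tx) mulrC.
  by rewrite (phi_notin TT Tx iT) mulr0.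
have lam0 i : i \in T -> 0 <= lam T i x by move: Tx => /(cellP _ TT); exact.
have t0 i : i \in T -> 0 <= lam T i x * (uh x - U ord0 i).
  by move=> iT; apply: mulr_ge0; [exact: lam0|rewrite subr_ge0; exact: hs TG iT].
move/(psumr_eq0P t0) => h0.
have : \sum_(i in T) lam T i x = 0.
  apply: big1 => i iT; have /eqP : lam T i x * (uh x - U ord0 i) = 0.
    exact: h0.
  rewrite mulf_eq0 => /orP[/eqP //|]; rewrite subr_eq0 => /eqP e.
  by exfalso; apply: ni; exists i; split => //; exists T.
by rewrite lam_sum// => /eqP; rewrite oner_eq0.
Qed.

(** The data are controlled only at vertices all of whose cells belong to [Gh], where [phi i] is
    supported in [G]. All vertices of [J] are of this kind, as they are interior to [G]. *)
Lemma no_interior_maximum s : (0 < d)%N -> is_max uh G s ->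
  (forall x, boundary G x -> uh x < s) ->
  (forall i, (forall T, T \in Th -> i \in T -> T \in Gh) ->
     gam i <= 0 /\ (0 < s \/ innerL2 Omega c (phi i) = 0)) -> False.
Proof.
move=> d0 [[x0 Gx0 uhx0] smax] bd hint_rhs.
pose VG := [set i | [exists T in Gh, i \in T]]%SET.
have VGP i : reflect (exists2 T, T \in Gh & i \in T) (i \in VG).
  by rewrite inE; apply: (iffP existsP) => [[T /andP[]]|[T TG iT]]; exists T => //; rewrite TG.
have VG_G i : i \in VG -> G (p i).
  by move=> /VGP[T TG iT]; apply/cellsP; exists T => //; exact: hull_vertex.
have VG_le i : i \in VG -> U ord0 i <= s by move=> /VG_G/smax; rewrite uh_vertex.
pose J := [set i in VG | U ord0 i == s]%SET.
have JP i : i \in J -> i \in VG /\ U ord0 i = s by rewrite inE => /andP[? /eqP].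
have JGi i : i \in J -> G° (p i).
  move=> /JP[iV Ui]; apply: contrapT => nGi.
  have := bd (p i); rewrite uh_vertex Ui ltxx => h; apply: notF; apply: h.
  by split => //; apply: subset_closure; exact: VG_G.
have JO i : i \in J -> Omega (p i).
  by move=> /JGi Gi; apply: regO; apply: interiorS Gi; exact: (cells_sub_closure hGh).
have JM i : i \in J -> (i < M)%N.
  move=> iJ; rewrite ltnNge; apply/negP => /hbnd[_].
  by rewrite (interior_id Omega).1//; apply; exact: JO.
have JT i : i \in J -> forall T, T \in Th -> i \in T -> T \in Gh.
  by move=> /JGi Gi T; exact: interior_vertex_cells.
have JN i j : i \in J -> j \in neighbours Th i -> j \in VG.
  move=> iJ; rewrite inE => /andP[_ /existsP[T /andP[TT /andP[iT jT]]]].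
  by apply/VGP; exists T => //; exact: JT iT.
have [i0 i0J] : exists i, i \in J.
  have [||i [iV Ui]] := @uh_max_vertex x0; first by [].
    by move=> T i TG iT; rewrite uhx0; apply: VG_le; apply/VGP; exists T.
  by exists i; rewrite inE; apply/andP; split; [exact/VGP|rewrite Ui uhx0].
have term i j : i \in J -> 0 <= at_ i j * (U ord0 j - s).
  move=> iJ; have [_ Ui] := JP i iJ; rewrite -Ui; apply: local_max_row; first exact: JM.
  by move=> l il; rewrite Ui; apply: VG_le; exact: JN il.
have row i : i \in J -> \sum_j at_ i j = innerL2 Omega c (phi i).
  by move=> iJ; rewrite big_split /= form_row ?JM// hBsum addr0.
have rowE i : i \in J ->
    \sum_j at_ i j * (U ord0 j - s) = gam i - s * innerL2 Omega c (phi i).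
  move=> iJ; under eq_bigr do rewrite mulrBr.
  by rewrite sumrB hU ?JM// -mulr_suml row// mulrC.
have s_react i : i \in J -> 0 <= s * innerL2 Omega c (phi i).
  move=> /JT/hint_rhs[_ [s0|->]]; last by rewrite mulr0.
  by rewrite mulr_ge0 ?reaction_ge0// ltW.
have row0 i : i \in J -> \sum_j at_ i j * (U ord0 j - s) = 0.
  move=> iJ; apply/eqP; rewrite eq_le sumr_ge0 ?andbT; last by move=> j _; exact: term.
  rewrite rowE// subr_le0; apply: le_trans (s_react i iJ).
  by have [] := hint_rhs i (JT i iJ).
(* If s > 0, the vanishing of the row means that s (c, phi_i) equals [gam i], which is
   nonpositive. *)
have react_le0 i : i \in J -> innerL2 Omega c (phi i) <= 0.
  move=> iJ; have [g0 [s0|->//]] := hint_rhs i (JT i iJ).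
  have /eqP := row0 i iJ; rewrite rowE// subr_eq0 => /eqP e.
  by rewrite -(pmulr_rle0 _ s0) -e.
have at0 i j : i \in J -> j \notin J -> at_ i j = 0.
  move=> iJ jJ; have ji : j != i by apply: contraNneq jJ => ->.
  have [ij|nij] := boolP (j \in neighbours Th i); last first.
    by rewrite form_far ?JM// hBsupp ?JM// addr0.
  have /psumr_eq0P := row0 i iJ => /(_ (fun l _ => term i l iJ)) /(_ j isT) /eqP.
  rewrite mulf_eq0 => /orP[/eqP //|]; rewrite subr_eq0 => Uj; exfalso.
  by move: jJ; rewrite inE Uj (JN i j iJ ij).
have block : \sum_(i in J) \sum_(j in J) at_ i j <= 0.
  apply: sumr_le0 => i iJ; rewrite (_ : \sum_(j in J) _ = \sum_j at_ i j).
    by rewrite row// react_le0.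
  rewrite [RHS](bigID (mem J))/= [X in _ = _ + X]big1 ?addr0// => j jJ.
  exact: at0.
(* A row of [B U] has sum 0, and for a row in [J] its entries outside of [J] are nonpositive, so the
   part inside [J] is nonnegative. The block of the form [ah] alone is thus bounded by the block of
   the full matrix. *)
have Bblock : 0 <= \sum_(i in J) \sum_(j in J) B U i j.
  apply: sumr_ge0 => i iJ; have := hBsum U i; rewrite (bigID (mem J))/= => /eqP.
  rewrite addr_eq0 => /eqP ->; rewrite oppr_ge0; apply: sumr_le0 => j jJ.
  by apply: hBneg; apply: contraNneq jJ => <-.
have := form_block_gt0 d0 JM i0J; rewrite ltNge => /negP; apply.
apply: le_trans block; under [leRHS]eq_bigr do rewrite big_split /=.
by rewrite big_split /= lerDl.
Qed.

Lemma uh_continuous : {within closure Omega, continuous uh}.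
Proof.
apply: continuous_big => [[y z]|i _]; first exact: add_continuous.
move=> x; apply: continuousM; first exact: cst_continuous.
by have [[+ _] _] := hphi i; exact.
Qed.

Lemma maximum_principle : (0 < d)%N -> Gh != finset.set0 ->
  (forall i, (forall T, T \in Th -> i \in T -> T \in Gh) -> gam i <= 0) ->
  (exists m mb, [/\ is_max uh G m,
    is_max (fun x => Num.max (uh x) 0) (boundary G) mb & m <= mb]) /\
  ((forall i, (forall T, T \in Th -> i \in T -> T \in Gh) ->
      innerL2 Omega c (phi i) = 0) ->
    exists2 m, is_max uh G m & is_max uh (boundary G) m).
Proof.
move=> d0 G0 gam0.
have cG := cells_compact hGh; have clG := cells_closed hGh.
have bG : boundary G `<=` G by move=> x [+ _]; rewrite -(closure_id _).1.
have cbG : compact (boundary G).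
  apply: subclosed_compact cG bG; apply: closedI; first exact: closed_closure.
  exact/open_closedC/open_interior.
have bG0 : boundary G !=set0 := cells_boundary_neq0 hGh d0 G0.
have G_neq0 : G !=set0 by have [x /bG] := bG0; exists x.
have cu : {within G, continuous uh}.
  exact: continuous_subspaceW (cells_sub_closure hGh) uh_continuous.
have cub : {within boundary G, continuous uh} by exact: continuous_subspaceW bG cu.
have [x Gx xmax] := compact_max G_neq0 cG cu.
have maxG : is_max uh G (uh x) by split; [exists x|].
split.
  have cub0 : {within boundary G, continuous (fun x => Num.max (uh x) 0)}.
    move=> y; apply: continuous_max; first exact: cub.
    exact: cst_continuous.
  have [y By ymax] := compact_max bG0 cbG cub0.
  exists (uh x), (Num.max (uh y) 0); split => //; first by split; [exists y|].
  rewrite leNgt; apply/negP => h; apply: (no_interior_maximum d0 maxG).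
    by move=> z /ymax; rewrite ge_max => /andP[z1 _]; apply: le_lt_trans z1 h.
  move=> i /gam0 ?; split=> //; left; apply: le_lt_trans h.
  by rewrite le_max lexx orbT.
move=> react0; have [y By ymax] := compact_max bG0 cbG cub.
exists (uh x) => //; suff <- : uh y = uh x by split; [exists y|].
apply/le_anti/andP; split; first by apply: xmax; exact: bG.
rewrite leNgt; apply/negP => h.
apply: (no_interior_maximum d0 maxG) => [z /ymax yz|i iG]; first exact: le_lt_trans yz h.
by split; [exact: gam0|right; exact: react0].
Qed.

End maximum.
End forms.

End triangulation_geometry.

(** * From the maximum principle to the theorem *)

Lemma divergence_free_test (R : realType) d (Omega : set 'rV[R]_d) (A : R)
    (b : 'rV[R]_d -> 'rV[R]_d) :
  measurable Omega -> (forall x, Omega x -> `|x| <= A) ->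
  (forall k, ess_bounded (lebesgue_rV d) Omega (fun x => b x ord0 k)) ->
  divergence_free Omega b ->
  forall psi, test_function Omega psi ->
  \int[lebesgue_rV d]_(x in Omega) (\sum_k b x ord0 k * partial k psi x) = 0.
Proof.
move=> mO hA bb [D [hD D0]] psi tpsi; have fO := bounded_rV_fin mO hA.
have [/[dup] spsi /(_ [::])[cpsi _] _ _] := tpsi.
have bpsi : ess_bounded (lebesgue_rV d) Omega psi by exact: (continuous_ess_bounded mO hA cpsi).
have bdpsi k : ess_bounded (lebesgue_rV d) Omega (partial k psi).
  by apply: (continuous_ess_bounded mO hA); have [] := spsi [:: k].
have bD k : ess_bounded (lebesgue_rV d) Omega (D k).
  by apply: Lp_oo_ess_bounded => //; have [[]] := hD k.
rewrite (Rintegral_sum_ess mO fO); last by move=> k _; exact: ess_boundedM.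
under eq_bigr => k _ do rewrite ((hD k).2 psi tpsi).
rewrite sumrN (_ : \sum_k _ = 0) ?oppr0//.
rewrite -(Rintegral_sum_ess mO fO); last by move=> k _; exact: ess_boundedM.
rewrite (@ae_eq_Rintegral _ _ _ _ _ _ (fun=> 0)); first by rewrite Rintegral_cst// mul0r.
by apply: filterS D0 => x Dx Ox; rewrite -mulr_suml Dx// mul0r.
Qed.

Lemma is_max_opp (R : realType) T (f : T -> R) (S : set T) m :
  is_max (fun x => - f x) S m -> is_min f S (- m).
Proof.
move=> [[x Sx fx] h]; split; first by exists x => //; rewrite -fx opprK.
by move=> y /h; rewrite lerNl.
Qed.

Unset Implicit Arguments.

Theorem theorem4 (R : realType) (d : nat) (hd : (0 < d)%N)
  (Omega : set 'rV[R]_d)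
  (hOmega : bounded_domain Omega)
  (hlip : lipschitz_boundary Omega)
  (hpoly : (1 < d)%N -> polyhedral (boundary Omega))
  (eps : R) (heps : 0 < eps)
  (b : 'rV[R]_d -> 'rV[R]_d)
  (hb : forall k, W1oo Omega (fun x => b x ord0 k))
  (hdiv : divergence_free Omega b)
  (c : 'rV[R]_d -> R) (sigma0 : R)
  (hc : Lp_space Omega +oo c) (hsigma0 : 0 <= sigma0)
  (hcs : {ae lebesgue_rV d, forall x, Omega x -> sigma0 <= c x})
  (g : 'rV[R]_d -> R) (hg : Lp_space Omega 2%:E g)
  (N M : nat) (hM : (0 < M)%N) (hMN : (M < N)%N)
  (p : 'I_N -> 'rV[R]_d) (Th : {set {set 'I_N}})
  (hTh : triangulation Omega p Th)
  (hint : forall i : 'I_N, (i < M)%N -> Omega (p i))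
  (hbnd : forall i : 'I_N, (M <= i)%N -> boundary Omega (p i))
  (phi : 'I_N -> 'rV[R]_d -> R) (hphi : nodal_basis Omega p Th phi)
  (ah : ('rV[R]_d -> R) -> ('rV[R]_d -> R) -> R)
  (hah : ah = form_a Omega eps b c \/
         ah = form_a_lumped Omega eps b c M p phi)
  (B : 'rV[R]_N -> 'M[R]_N)
  (hBsym : forall U i j, B U i j = B U j i)
  (hBneg : forall U i j, i != j -> B U i j <= 0)
  (hBsum : forall U i, \sum_(j < N) B U i j = 0)
  (hBsupp : forall U (i j : 'I_N), (i < M)%N ->
     j \notin neighbours Th i -> j != i -> B U i j = 0)
  (hA1_cont : forall i j : 'I_N, (i < M)%N ->
     continuous (fun U : 'rV[R]_N => B U i j * (U ord0 j - U ord0 i)))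
  (hA1_bnd : forall i j : 'I_N, (i < M)%N -> (M <= j)%N ->
     exists K : R, forall U, `|B U i j| <= K)
  (hA2 : forall (U : 'rV[R]_N) (i : 'I_N), (i < M)%N ->
     (forall j, j \in neighbours Th i -> U ord0 j < U ord0 i) \/
     (forall j, j \in neighbours Th i -> U ord0 i < U ord0 j) ->
     forall j, j \in neighbours Th i -> ah (phi j) (phi i) + B U i j <= 0)
  (Gh : {set {set 'I_N}}) (hGh : Gh \subset Th) (hGh0 : Gh != finset.set0)
  (U : 'rV[R]_N)
  (hU : forall i : 'I_N, (i < M)%N ->
     \sum_(j < N) (ah (phi j) (phi i) + B U i j) * U ord0 j
     = innerL2 Omega g (phi i)) :
  let G := cells p Gh in
  let uh := fun x => \sum_(i < N) U ord0 i * phi i x in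
  let g_le0 := {ae lebesgue_rV d, forall x, G x -> g x <= 0} in
  let g_ge0 := {ae lebesgue_rV d, forall x, G x -> 0 <= g x} in
  [/\ g_le0 -> exists m mb, [/\ is_max uh G m,
        is_max (fun x => Num.max (uh x) 0) (boundary G) mb & m <= mb],
      g_ge0 -> exists m mb, [/\ is_min uh G m,
        is_min (fun x => Num.min (uh x) 0) (boundary G) mb & mb <= m] &
      {ae lebesgue_rV d, forall x, G x -> c x = 0} ->
        (g_le0 -> exists2 m, is_max uh G m & is_max uh (boundary G) m) /\
        (g_ge0 -> exists2 m, is_min uh G m & is_min uh (boundary G) m)].
Proof.
have [_ oO _ [A0 [_ hA0]]] := hOmega.
have regO := lipschitz_boundary_regular oO hlip.
pose A := A0 + 1.
have hAO x : Omega x -> `|x| <= A by move=> Ox; apply: (hA0 A) => //; rewrite ltrDl.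
have hA x : closure Omega x -> `|x| <= A.
  have clA : closed [set y : 'rV[R]_d | `|y| <= A].
    apply: (@closed_comp _ _ (fun y : 'rV[R]_d => `|y|) [set r | r <= A]) => //.
    by move=> y _; exact: norm_continuous.
  move=> clx; suff : closure [set y : 'rV[R]_d | `|y| <= A] x by rewrite -(closure_id _).1.
  by apply: closureS clx => y /hAO.
have mO := measurable_rV_open oO.
have [gr [cs hgr]] : exists gr cs, affine_pieces p Th phi gr cs.
  have /choice[qr hqr] : forall Ti : {set 'I_N} * 'I_N, exists qr : 'rV[R]_d * R,
      Ti.1 \in Th -> forall y, hull p Ti.1 y -> phi Ti.2 y = dotv qr.1 y + qr.2.
    move=> [T i]; have [TT|] := boolP (T \in Th); last by move=> _; exists (0, 0).
    by have [[_ /(_ T TT)[q [r h]]] _] := hphi i; exists (q, r).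
  exists (fun T i => (qr (T, i)).1), (fun T i => (qr (T, i)).2) => T i y TT Ty.
  exact: (hqr (T, i) TT y Ty).
have bb k : ess_bounded (lebesgue_rV d) Omega (fun x => b x ord0 k).
  by apply: Lp_oo_ess_bounded => //; have [] := hb k.
have bc := Lp_oo_ess_bounded mO hc.
have c0 : {ae lebesgue_rV d, forall x, Omega x -> 0 <= c x}.
  by apply: filterS hcs => x h Ox; rewrite (le_trans hsigma0)// h.
have divb := divergence_free_test mO hAO bb hdiv.
move=> G uh g_le0 g_ge0.
(* On [Omega], [phi i] vanishes outside of the cells at [p i]; if these all belong to [Gh], the sign
   of a function on [G] decides the sign of its inner product with [phi i]. *)
have supp i x : (forall T, T \in Th -> i \in T -> T \in Gh) -> Omega x ->
    phi i x = 0 \/ G x /\ 0 <= phi i x.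
  move=> iG /subset_closure Ox; have := phi_ge0 hTh hphi hgr i Ox.
  have /(closureP hTh)[T TT Tx] := Ox; have [iT phi0|iT _] := boolP (i \in T).
    by right; split => //; apply/cellsP; exists T => //; exact: iG.
  by left; exact: (phi_notin hTh hphi hgr TT Tx iT).
have rhs_le0 (f : 'rV[R]_d -> R) : {ae lebesgue_rV d, forall x, G x -> f x <= 0} ->
    forall i, (forall T, T \in Th -> i \in T -> T \in Gh) -> innerL2 Omega f (phi i) <= 0.
  move=> f0 i iG; apply: Rintegral_ae_le0; apply: filterS f0 => x f0 Ox.
  have [->|[Gx phi0]] := supp i x iG Ox; first by rewrite mulr0.
  by rewrite mulr_le0_ge0// f0.
have rhs_ge0 (f : 'rV[R]_d -> R) : {ae lebesgue_rV d, forall x, G x -> 0 <= f x} ->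
    forall i, (forall T, T \in Th -> i \in T -> T \in Gh) -> 0 <= innerL2 Omega f (phi i).
  move=> f0 i iG; apply: Rintegral_ae_ge0; apply: filterS f0 => x f0 Ox.
  have [->|[Gx phi0]] := supp i x iG Ox; first by rewrite mulr0.
  by rewrite mulr_ge0// f0.
have react0 : {ae lebesgue_rV d, forall x, G x -> c x = 0} ->
    forall i, (forall T, T \in Th -> i \in T -> T \in Gh) -> innerL2 Omega c (phi i) = 0.
  move=> cG i iG; apply/le_anti/andP; split.
    by apply: rhs_le0 iG; apply: filterS cG => x h /h ->.
  by apply: rhs_ge0 iG; apply: filterS cG => x h /h ->.
have maxP := @maximum_principle R d N Omega p Th phi gr cs hTh hphi hgr oO regO A hA
  b c eps bb bc c0 heps divb M hint ah hah.
have maxU := maxP B hBneg hBsum hBsupp hA1_cont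
  (fun V i iM h => hA2 V i iM (or_introl h)) hbnd Gh hGh U _ hU hd hGh0.
(* [- U] solves the system with the matrices [B (- V)] and the right-hand side of [- g]; the
   following facts transfer the hypotheses to this system. *)
have hA1N (i j : 'I_N) : (i < M)%N -> continuous (fun V : 'rV[R]_N =>
    B (- V) i j * (V ord0 j - V ord0 i)).
  move=> iM V.
  have -> : (fun V : 'rV[R]_N => B (- V) i j * (V ord0 j - V ord0 i)) =
      (fun V : 'rV[R]_N => - (B V i j * (V ord0 j - V ord0 i))) \o -%R.
    by apply/funext => W /=; rewrite !mxE; ring.
  apply: continuous_comp; first exact: opp_continuous.
  by apply: continuousN; exact: hA1_cont.
have hUN (i : 'I_N) : (i < M)%N ->
    \sum_(j < N) (ah (phi j) (phi i) + B (- - U) i j) * (- U) ord0 j =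
    - innerL2 Omega g (phi i).
  move=> iM; rewrite opprK -hU// -sumrN; apply: eq_bigr => j _.
  by rewrite mxE mulrN.
have hA2N (V : 'rV[R]_N) (i : 'I_N) : (i < M)%N ->
    (forall j, j \in neighbours Th i -> V ord0 j < V ord0 i) ->
    forall j, j \in neighbours Th i -> ah (phi j) (phi i) + B (- V) i j <= 0.
  move=> iM h; apply: hA2 => //; right=> j /h; by rewrite !mxE ltrN2.
have minU := maxP (fun V => B (- V)) (fun V => hBneg (- V)) (fun V => hBsum (- V))
  (fun V => hBsupp (- V)) hA1N hA2N hbnd Gh hGh (- U) _ hUN hd hGh0.
have uhN : (fun x => \sum_(i < N) (- U) ord0 i * phi i x) = (fun x => - uh x).
  by apply/funext => x; rewrite /uh -sumrN; apply: eq_bigr => i _; rewrite mxE mulNr.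
rewrite uhN in minU.
have gN_le0 : g_ge0 -> forall i, (forall T, T \in Th -> i \in T -> T \in Gh) ->
    - innerL2 Omega g (phi i) <= 0.
  by move=> g0 i iG; rewrite oppr_le0; exact: rhs_ge0.
split.
- by move=> /rhs_le0/maxU[].
- move=> /gN_le0/minU[[m [mb [hm hmb mmb]]] _]; exists (- m), (- mb); split.
  + exact: is_max_opp.
  + apply: is_max_opp.
    rewrite (_ : (fun x => - _) =
      (fun x => Num.max (\sum_(i < N) (- U) ord0 i * phi i x) 0))//.
    apply/funext => x; rewrite oppr_min oppr0; congr (Num.max _ 0).
    exact/esym/(congr1 (@^~ x) uhN).
  + by rewrite lerN2.
- move=> /react0 cG; split; first by move=> /rhs_le0/maxU[_]; exact.
  move=> /gN_le0/minU[_ /(_ cG)[m hm hmb]].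
  by exists (- m); exact: is_max_opp.
Qed.
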